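(* Let $I$ be an ideal. Then the following conditions are equivalent. (i) $I$ is am-closed. (ii) $I$ is invariant under substochastic matrices. (ii$'$) $I$ is invariant under one of the following classes of substochastic matrices: row-stochastic, column-stochastic, doubly stochastic, isometry stochastic, co-isometry stochastic, unistochastic, orthostochastic. (iii) $I\supset\mathscr L_1$ and $I$ is invariant under block stochastic matrices. (iii$'$) $I\supset\mathscr L_1$ and $I$ is invariant under block orthostochastic matrices.
   Context: $\mathrm{c}_{\mathrm{o}}^*$ denotes the cone of nonnegative monotone nonincreasing sequences converging to $0$ (not a dual space). $H$ is a complex separable infinite-dimensional Hilbert space with a fixed orthonormal basis; infinite matrices are identified with operators. An ideal is a nonzero two-sided ideal of $B(H)$ contained in the compact operators; $\mathscr L_1$ is the trace class. $s(X)$ is the nonincreasing sequence of singular numbers of a compact operator $X$ (with multiplicity, with infinitely many zeros added if $X$ has finite rank). The characteristic set of $I$ is $\Sigma(I):=\{s(X)\mid X\in I\}\subset \mathrm{c}_{\mathrm{o}}^*$; it determines $I$ (Calkin). For $\xi\in \mathrm{c}_{\mathrm{o}}^*$, $\xi_a:=\langle\frac1n\sum_{j=1}^n\xi_j\rangle$. The ideals ${}_aI$ and $I_a$ have characteristic sets $\Sigma({}_aI)=\{\xi\in \mathrm{c}_{\mathrm{o}}^*\mid\xi_a\in\Sigma(I)\}$ and $\Sigma(I_a)=\{\xi\in \mathrm{c}_{\mathrm{o}}^*\mid\xi=O(\eta_a)\text{ for some }\eta\in\Sigma(I)\}$, where $\xi=O(\zeta)$ means $\xi_n\le M\zeta_n$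 for some $M>0$ and all $n$. The am-closure of $I$ is $I^-:={}_a(I_a)$, and $I$ is am-closed if $I=I^-$. An infinite matrix $P$ with nonnegative entries is: substochastic if its row and column sums are at most $1$; column-stochastic (resp. row-stochastic) if it is substochastic with all column (resp. row) sums equal to $1$; doubly stochastic if both; block stochastic if it is a direct sum of finite doubly stochastic matrices. If $Q_{ij}=|L_{ij}|^2$ for all $i,j$ for a contraction $L$, then $Q$ is isometry stochastic, co-isometry stochastic, unistochastic, or orthostochastic if $L$ can be taken to be, respectively, an isometry, a co-isometry, a unitary, or an orthogonal matrix (unitary with real entries); it is block orthostochastic if $L$ is a direct sum of finite orthogonal matrices. For $\xi\in \mathrm{c}_{\mathrm{o}}^*$ and $P$ substochastic, $P\xi:=\langle\sum_jP_{ij}\xi_j\rangle_i$ is a nonnegative sequence converging to $0$, and $(P\xi)^*\in \mathrm{c}_{\mathrm{o}}^*$ denotes its monotone nonincreasing rearrangement. For a collection $\mathscr P$ of substochastic matrices, $I$ is invariant under $\mathscr P$ if $(P\xi)^*\in\Sigma(I)$ for every $P\in\mathscr P$ and every $\xi\in\Sigma(I)$. *)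

(* Defs.v *)
From HB Require Import structures.
From mathcomp Require Import all_boot all_order all_algebra.
From mathcomp Require Import all_classical all_reals all_analysis.
From mathcomp Require Import complex.

Set Implicit Arguments.
Unset Strict Implicit.
Unset Printing Implicit Defensive.

Import Order.TTheory GRing.Theory Num.Theory Num.Def.
Import numFieldNormedType.Exports.

Local Open Scope card_scope.
Local Open Scope classical_set_scope.
Local Open Scope complex_scope.
Local Open Scope ring_scope.

Section Sequences.
Context {R : realType}.
Implicit Types (xi eta zeta : nat -> R) (P : nat -> nat -> R).

(* The cone c_o^*; sequences and matrices are indexed from 0. *)
Definition co_star : set (nat -> R) :=
  [set xi | [/\ forall n, 0 <= xi n, nonincreasing_seq xi & xi @ \oo --> (0 : R)]].

Definition bigO_seq xi zeta : Prop :=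
  exists2 M : R, 0 < M & forall n, xi n <= M * zeta n.

(* xi is zeta^*: both take every value lambda > 0 the same number of times.
   In particular, the zeros of zeta are dropped when zeta has infinitely many
   positive terms. *)
Definition is_rearrangement zeta xi : Prop :=
  co_star xi /\
  forall lambda : R, 0 < lambda ->
    [set n | xi n = lambda] #= [set n | zeta n = lambda].

Definition nonneg_matrix P : Prop := forall i j, 0 <= P i j.
Definition row_sum P (i : nat) : \bar R := (\sum_(0 <= j <oo) (P i j)%:E)%E.
Definition col_sum P (j : nat) : \bar R := (\sum_(0 <= i <oo) (P i j)%:E)%E.

Definition substochastic P : Prop :=
  [/\ nonneg_matrix P, forall i, (row_sum P i <= 1)%E
    & forall j, (col_sum P j <= 1)%E].

Definition row_stochastic P : Prop :=
  substochastic P /\ forall i, row_sum P i = 1%E.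

Definition column_stochastic P : Prop :=
  substochastic P /\ forall j, col_sum P j = 1%E.

Definition doubly_stochastic P : Prop :=
  row_stochastic P /\ column_stochastic P.

Definition fin_doubly_stochastic n (B : 'M[R]_n) : Prop :=
  [/\ forall i j, 0 <= B i j, forall i, \sum_j B i j = 1
    & forall j, \sum_i B i j = 1].

Definition apply_matrix P xi : nat -> R :=
  fun i => limn (series (fun j => P i j * xi j)).

End Sequences.

(* The infinite matrix A is a direct sum of finite square matrices satisfying K:
   the k-th diagonal block occupies the indices i with b k <= i < b k.+1. *)
Definition direct_sum_of {T : nmodType} (K : forall n, 'M[T]_n -> Prop)
    (A : nat -> nat -> T) : Prop :=
  exists b : nat -> nat,
    [/\ b 0%N = 0%N, forall k, (b k < b k.+1)%N,
        forall k, K (b k.+1 - b k)%N (\matrix_(i, j) A (b k + i)%N (b k + j)%N)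
      & forall i j, A i j != 0 ->
          exists k, (b k <= i < b k.+1)%N /\ (b k <= j < b k.+1)%N].

Definition block_stochastic {R : realType} (P : nat -> nat -> R) : Prop :=
  direct_sum_of (@fin_doubly_stochastic R) P.

Section Operators.
Context {R : realType} {H : completeNormedModType R[i]}.
Variables (dot : {dot H for conjC}) (e : nat -> H).
Implicit Types (X Y L : {linear H -> H}) (I : set {linear H -> H}).
Implicit Types (xi s : nat -> R) (Q : nat -> nat -> R).

(* dot is linear in its first argument and conjugate-linear in the second. *)
Definition hilbert_inner_product : Prop := forall x : H, `|x| ^+ 2 = dot x x.

Definition orthonormal_basis : Prop :=
  (forall i j, dot (e i) (e j) = (i == j)%:R) /\
  (forall x : H, series (fun n => dot x (e n) *: e n) @ \oo --> x).

Definition bounded_op X : Prop := continuous X.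

Definition compact_op X : Prop :=
  compact (closure (X @` [set x : H | `|x| <= 1])).

Definition is_adjoint X Y : Prop := forall x y : H, dot (X x) y = dot x (Y y).

Definition has_dim (k : nat) (V : set H) : Prop :=
  exists b : 'I_k -> H,
    (forall c : 'I_k -> R[i], \sum_i c i *: b i = 0 -> forall i, c i = 0) /\
    V = [set x | exists c : 'I_k -> R[i], x = \sum_i c i *: b i].

(* s = s(X): the nonzero singular numbers of X are the square roots of the
   nonzero eigenvalues of X^* X, repeated according to multiplicity. *)
Definition singular_numbers X s : Prop :=
  co_star s /\
  exists2 Y, is_adjoint X Y &
    forall lambda : R, 0 < lambda ->
      exists k : nat, [set n | s n = lambda] #= `I_k /\
        has_dim k [set x | Y (X x) = (lambda ^+ 2)%:C *: x].

Definition is_ideal I : Prop :=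
  [/\ exists2 X, I X & exists x, X x != 0,
      I `<=` compact_op,
      forall X Y, I X -> I Y -> I (X \+ Y : {linear H -> H}),
      forall X Y, bounded_op X -> I Y -> I (X \o Y : {linear H -> H})
    & forall X Y, I X -> bounded_op Y -> I (X \o Y : {linear H -> H})].

Definition char_set I : set (nat -> R) :=
  [set s | exists2 X, I X & singular_numbers X s].

(* The ideal with a given characteristic set (Calkin correspondence). *)
Definition ideal_of (S : set (nat -> R)) : set {linear H -> H} :=
  [set X | compact_op X /\ exists2 s, singular_numbers X s & S s].

Definition trace_class : set {linear H -> H} :=
  ideal_of [set s | co_star s /\ (\sum_(0 <= n <oo) (s n)%:E < +oo)%E].

(* pre_am I is _aI and am I is I_a; both are specified by their characteristic
   sets. *)
Definition pre_am I : set {linear H -> H} :=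
  ideal_of [set xi | co_star xi /\ char_set I (arithmetic_mean xi)].

Definition am I : set {linear H -> H} :=
  ideal_of [set xi | co_star xi /\
    exists2 eta, char_set I eta & bigO_seq xi (arithmetic_mean eta)].

Definition am_closure I : set {linear H -> H} := pre_am (am I).

Definition am_closed I : Prop := I = am_closure I.

Definition invariant_under (Pcls : set (nat -> nat -> R)) I : Prop :=
  forall P xi, Pcls P -> char_set I xi ->
    exists2 zeta, is_rearrangement (apply_matrix P xi) zeta & char_set I zeta.

Definition matrix_of L : nat -> nat -> R[i] := fun i j => dot (L (e j)) (e i).

Definition contraction L : Prop := forall x, `|L x| <= `|x|.
Definition isometric L : Prop := forall x, `|L x| = `|x|.
Definition coisometric L : Prop := exists2 L', is_adjoint L L' & isometric L'.
Definition unitary L : Prop := isometric L /\ coisometric L.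
Definition orthogonal_op L : Prop :=
  unitary L /\ forall i j, matrix_of L i j \is Num.real.

Definition fin_orthogonal n (B : 'M[R[i]]_n) : Prop :=
  (forall i j, B i j \is Num.real) /\ B *m B^T = 1%:M.

Definition block_orthogonal L : Prop :=
  direct_sum_of fin_orthogonal (matrix_of L).

Definition stochastic_from (Lcls : set {linear H -> H}) Q : Prop :=
  exists L, [/\ contraction L, Lcls L
    & forall i j, (Q i j)%:C = `|matrix_of L i j| ^+ 2].

Definition isometry_stochastic := stochastic_from isometric.
Definition coisometry_stochastic := stochastic_from coisometric.
Definition unistochastic := stochastic_from unitary.
Definition orthostochastic := stochastic_from orthogonal_op.
Definition block_orthostochastic := stochastic_from block_orthogonal.

End Operators.

(* Main.v *)
(** Write xi_a for the arithmetic mean of xi, so that xi_a <= eta_a says that xi is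
    weakly majorized by eta.  If P is substochastic, (P xi)^*_a <= xi_a, hence
    am-closed ideals are invariant under substochastic matrices.

    Conversely let I be invariant under block orthostochastic matrices, with L_1
    inside I, and let xi_a <= M eta_a with s(Y) = eta for some Y in I.  If xi is not
    summable, the gap between the partial sums of 2 M eta and xi tends to infinity;
    cutting at its successive minima gives finite blocks on which 2 M eta weakly
    majorizes xi, and Horn's theorem applied to each block yields a block
    orthostochastic P with xi <= 2 M P eta.  That L_1 is contained in an ideal
    invariant under orthostochastic matrices follows from a Householder reflection
    whose first column is the square root of a given sequence of sum 1.

    Sequences are transferred to operators by the singular value decomposition:
    an operator with s(X) = O(s(Z)) factors as X = U Z V. *)
Require Import Defs.
From HB Require Import structures.
From mathcomp Require Import all_boot all_order all_algebra.
From mathcomp Require Import all_classical all_reals all_analysis.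
From mathcomp Require Import complex finmap.
From mathcomp Require Import ring lra zify.
Set Implicit Arguments.
Unset Strict Implicit.
Unset Printing Implicit Defensive.
Import Order.TTheory GRing.Theory Num.Theory Num.Def.
Import numFieldNormedType.Exports.
Local Open Scope card_scope.
Local Open Scope classical_set_scope.
Local Open Scope complex_scope.
Local Open Scope ring_scope.

(** Only domination is transported, never equality. An ideal contains every compact operator whose
    singular numbers are bounded by a multiple of those of a member, so Horn's theorem is needed
    merely as an inequality between [x] and the new diagonal. Likewise a decreasing sequence that
    lies below [P eta] still lies below its rearrangement. The obstacle is the summable case. A
    block matrix sends a finitely supported sequence to a finitely supported one, so the ideal of
    finite-rank operators is invariant under block stochastic matrices without being am-closed: its
    am-closure is the trace class. Spreading one value over infinitely many rows takes a matrix with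
    an infinite column, which is what the Householder reflection supplies. The orthostochastic
    matrices form the smallest of the seven classes in (ii'), so the return from any of these
    classes to am-closedness passes through them. *)

(** Choice in which a term may depend on the list of all its predecessors. It yields both the greedy
    rearrangement and the successive singular vectors. *)
Lemma history_choice (T : Type) (Q : seq T -> T -> Prop) :
  (forall s, exists t, Q s t) -> exists f : nat -> T, forall n, Q (mkseq f n) (f n).
Proof.
move=> /choice[g Qg].
pose pre := fix pre n := if n is m.+1 then rcons (pre m) (g (pre m)) else [::].
exists (fun n => g (pre n)) => n.
suff -> : mkseq (fun n => g (pre n)) n = pre n by [].
by elim: n => //= n IH; rewrite mkseqS IH.
Qed.

(** * Decreasing rearrangements of null sequences *)

Section Sequences.
Context {R : realType}.
Implicit Types (z xi eta : nat -> R) (P : nat -> nat -> R).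

(** If some term outside [s] is positive, the terms from some index on lie below it and the maximum
    is taken over a finite range; otherwise every term outside [s] is 0. *)
Lemma null_seq_max_outside z (s : seq nat) :
  (forall n, 0 <= z n) -> z @ \oo --> (0 : R) ->
  exists2 n, n \notin s & forall i, i \notin s -> z i <= z n.
Proof.
move=> z0 cz.
have [i0 i0s] : exists i0, i0 \notin s.
  exists (sumn s).+1; apply/negP; suff H i : i \in s -> (i <= sumn s)%N.
    by move=> /H; rewrite ltnn.
  elim: s => //= a s IH; rewrite inE => /orP[/eqP->|/IH]; lia.
have [[i1 i1s z1]|h] := pselect (exists2 i, i \notin s & 0 < z i); last first.
  exists i0 => // i is_; have [->|zi] := eqVneq (z i) 0; first exact: z0.
  by exfalso; apply: h; exists i => //; rewrite lt_neqAle eq_sym zi z0.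
have /cvgrPdist_lt /(_ _ z1) [N _ Nz] := cz.
pose B := (N + i1.+1)%N.
have i1B : (i1 < B)%N by rewrite /B; lia.
case: (@arg_maxP _ _ _ (Ordinal i1B) (fun i : 'I_B => (i : nat) \notin s)
  (fun i : 'I_B => z i) i1s) => j js jmax.
exists (j : nat) => // i is_.
have [iB|Bi] := ltnP i B; first exact: (jmax (Ordinal iB)).
apply: (@le_trans _ _ (z i1)); last exact: (jmax (Ordinal i1B)).
have := Nz i; rewrite /= sub0r normrN ger0_norm // => h; apply/ltW/h.
by rewrite /B in Bi; lia.
Qed.

(** Such a [sigma] is injective but may miss indices where [z] vanishes; this suffices because
    [is_rearrangement] counts positive values only. *)
Definition greedy z (sigma : nat -> nat) :=
  forall n, sigma n \notin mkseq sigma n /\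
    forall i, i \notin mkseq sigma n -> z i <= z (sigma n).

Lemma greedy_exists z : (forall n, 0 <= z n) -> z @ \oo --> (0 : R) ->
  exists sigma, greedy z sigma.
Proof.
move=> z0 cz; apply: (history_choice
  (Q := fun s n => n \notin s /\ forall i, i \notin s -> z i <= z n)) => s.
by have [n] := null_seq_max_outside s z0 cz; exists n.
Qed.

Section Greedy.
Variables (z : nat -> R) (sigma : nat -> nat).
Hypotheses (z0 : forall n, 0 <= z n) (cz : z @ \oo --> (0 : R)) (gs : greedy z sigma).

Lemma greedy_inj : injective sigma.
Proof.
have H m n : (m < n)%N -> sigma m != sigma n.
  move=> mn; have [/mapP h _] := gs n; apply/eqP => e; apply: h; exists m => //.
  by rewrite mem_iota.
move=> m n e; apply/eqP; have [/H|/H|//] := ltngtP m n; by rewrite e eqxx.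
Qed.

Lemma greedy_nonincreasing : nonincreasing_seq (z \o sigma).
Proof.
move=> m n mn /=; have [_] := gs m; apply; apply/mapP => -[k].
by rewrite mem_iota /= add0n => km /greedy_inj e; lia.
Qed.

Lemma inj_cvg0 : z (sigma n) @[n --> \oo] --> (0 : R).
Proof.
apply/cvgrPdist_lt => e e0; have /cvgrPdist_lt /(_ _ e0) [N _ Nz] := cz.
have : \forall n \near \oo, (N <= sigma n)%N.
  have [M MP] : exists M, forall n, (sigma n < N)%N -> (n < M)%N.
    elim: N {Nz} => [|N [M MP]]; first by exists 0%N.
    have [[k kN]|h] := pselect (exists k, sigma k = N).
      exists (maxn M k.+1) => n; rewrite ltnS leq_eqVlt => /orP[/eqP e1|/MP]; last lia.
      by rewrite -kN in e1; rewrite (greedy_inj e1); lia.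
    exists M => n; rewrite ltnS leq_eqVlt => /orP[/eqP e1|/MP//].
    by case: h; exists n.
  exists M => // n /=; apply: contraTT; rewrite -!ltnNge => /MP; lia.
by apply: filterS => n Nn; exact: (Nz (sigma n)).
Qed.

Lemma greedy_co_star : co_star (z \o sigma).
Proof. by split; [move=> n; exact: z0|exact: greedy_nonincreasing|exact: inj_cvg0]. Qed.

(** An index that is never picked stays eligible, so its value bounds every [z (sigma n)] from
    below, against the limit 0. *)
Lemma greedy_surj i : 0 < z i -> exists n, sigma n = i.
Proof.
move=> zi; apply: contrapT => h.
have /cvgrPdist_lt /(_ _ zi) [N _ /(_ N (leqnn N))] := inj_cvg0.
rewrite /= sub0r normrN ger0_norm // ltNge => /negP; apply.
have [_] := gs N; apply; apply/mapP => -[k _ e]; by apply: h; exists k.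
Qed.

Lemma greedy_rearrangement : is_rearrangement z (z \o sigma).
Proof.
split; first exact: greedy_co_star.
move=> l l0; have -> : [set n | z n = l] = sigma @` [set n | (z \o sigma) n = l].
  apply/seteqP; split => [i /= zi|_ [n /= zn <-]//].
  have [n e] : exists n, sigma n = i by apply: greedy_surj; rewrite zi.
  by exists n => //=; rewrite e.
by rewrite card_eq_sym; apply: inj_card_eq => ? ? _ _; exact: greedy_inj.
Qed.

(** Pigeonhole: before step [n] only [n] indices are used, so some [i <= n] is still free and
    [xi n <= xi i <= z i <= z (sigma n)]. *)
Lemma greedy_ge xi : nonincreasing_seq xi -> (forall n, xi n <= z n) ->
  forall n, xi n <= z (sigma n).
Proof.
move=> xid xiz n.
have [i iN inot] : exists2 i, (i <= n)%N & i \notin mkseq sigma n.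
  apply: contrapT => h.
  have : (size (iota 0 n.+1) <= size (mkseq sigma n))%N.
    apply: uniq_leq_size; first exact: iota_uniq.
    move=> i; rewrite mem_iota /= add0n ltnS => iN.
    by apply: contrapT => /negP inot; apply: h; exists i.
  by rewrite size_iota size_mkseq ltnn.
have [_ /(_ _ inot)] := gs n; apply: le_trans.
by apply: le_trans (xiz i); exact: xid.
Qed.

End Greedy.

Lemma card_eq_subset_eq (A B : set nat) : finite_set B -> A `<=` B -> A #= B -> A = B.
Proof.
move=> fB AB cAB; have fA := sub_finite_set AB fB.
have [n Bn] := fB.
suff /eqP : fset_set A == fset_set B by apply: fset_set_inj.
rewrite eqEfcard; apply/andP; split.
  by rewrite -(fset_set_sub fA fB).
by rewrite (card_fset_set Bn) (card_fset_set (card_eq_trans cAB Bn)).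
Qed.

Lemma co_star_level_finite xi (l : R) : co_star xi -> 0 < l -> finite_set [set n | xi n = l].
Proof.
move=> [_ _ cx] l0; have /cvgrPdist_lt /(_ _ l0) [N _ Nz] := cx.
apply: (sub_finite_set _ (finite_II N)) => n /= xn; rewrite ltnNge; apply/negP => /Nz /=.
by rewrite xn sub0r normrN gtr0_norm // ltxx.
Qed.

(** At a first index [n] with [x n < y n], the level set of [x] at [y n] lies below [n], hence
    inside that of [y]. Equal finite cardinality makes the two sets equal, yet [n] belongs only to
    the second. *)
Lemma co_star_eq xi eta : co_star xi -> co_star eta ->
  (forall l : R, 0 < l -> [set n | xi n = l] #= [set n | eta n = l]) -> xi = eta.
Proof.
have H (x y : nat -> R) n : co_star x -> co_star y ->
    (forall l : R, 0 < l -> [set n | x n = l] #= [set n | y n = l]) ->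
    (forall m, (m < n)%N -> x m = y m) -> y n <= x n.
  move=> cx cy xy h; rewrite leNgt; apply/negP => xlty.
  have l0 : 0 < y n by apply: le_lt_trans xlty; case: cx.
  suff : [set m | x m = y n] = [set m | y m = y n].
    by move=> /seteqP[_ /(_ n erefl)] /= e; rewrite e ltxx in xlty.
  apply: card_eq_subset_eq; [exact: co_star_level_finite| |exact: xy].
  move=> m /= xm; rewrite -h //; rewrite ltnNge; apply/negP => nm.
  by move: xlty; rewrite -xm ltNge; case: cx => _ /(_ _ _ nm) ->.
move=> cx cy xy; apply/funext; apply: ltn_ind => n IH; apply/eqP; rewrite eq_le !H //.
  by move=> l l0; rewrite card_eq_sym xy.
by move=> m /IH.
Qed.

(** By uniqueness the given rearrangement is the greedy one, to which the pigeonhole bound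
    applies. *)
Lemma le_rearrangement z zeta xi : (forall n, 0 <= z n) -> z @ \oo --> (0 : R) ->
  is_rearrangement z zeta -> nonincreasing_seq xi -> (forall n, xi n <= z n) ->
  forall n, xi n <= zeta n.
Proof.
move=> z0 cz [cze zz] xid xiz n; have [s gs] := greedy_exists z0 cz.
have [cs ss] := greedy_rearrangement z0 cz gs.
rewrite (@co_star_eq zeta (z \o s)) //; first exact: (greedy_ge gs).
by move=> l l0; apply: card_eq_trans (zz l l0) _; rewrite card_eq_sym ss.
Qed.

Lemma finite_nat_enum (P : pred nat) N : (forall n, P n -> (n < N)%N) ->
  [set n | P n] #= `I_(size [seq n <- iota 0 N | P n]).
Proof.
move=> PN; pose r := [seq n <- iota 0 N | P n]; rewrite -/r card_eq_sym.
have -> : [set n | P n] = [set nth 0%N r i | i in `I_(size r)].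
  apply/seteqP; split => [n /= Pn|_ [i /= ir <-]].
    have nr : n \in r by rewrite mem_filter Pn mem_iota /= PN.
    by exists (index n r); rewrite /= ?index_mem // nth_index.
  by have := mem_nth 0%N ir; rewrite mem_filter => /andP[].
rewrite card_eq_sym; apply: inj_card_eq => i j /set_mem ir /set_mem jr /eqP.
by rewrite nth_uniq ?filter_uniq ?iota_uniq // => /eqP.
Qed.

(** * Arithmetic means and nonnegative series *)

Lemma co_star_arithmetic_mean xi : co_star xi -> co_star (arithmetic_mean xi).
Proof.
move=> [xi0 xid xic]; split; last exact: cesaro.
  by move=> n; rewrite /arithmetic_mean /= mulr_ge0 ?invr_ge0 // sumr_ge0.
apply/nonincreasing_seqP => n; rewrite /arithmetic_mean /=.
rewrite ler_pdivrMl ?ltr0Sn // mulrCA -ler_pdivrMl ?ltr0Sn // invrK.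
have h : n.+1%:R * xi n.+1 <= series xi n.+1.
  rewrite mulr_natl -[X in _ *+ X]subn0 -sumr_const_nat /series /= !big_nat.
  by apply: ler_sum => i /andP[_ iN]; apply: xid; exact: ltnW.
rewrite /series /= big_nat_recr //= -/(series xi n.+1) mulrDr -[n.+2%:R]natr1 mulrDl mul1r.
by rewrite lerD2l.
Qed.

Lemma arithmetic_mean_le xi eta (M : R) :
  (forall n, arithmetic_mean xi n <= M * arithmetic_mean eta n) <->
  forall n, \sum_(0 <= k < n) xi k <= M * \sum_(0 <= k < n) eta k.
Proof.
have E n : (arithmetic_mean xi n <= M * arithmetic_mean eta n) =
    (\sum_(0 <= k < n.+1) xi k <= M * \sum_(0 <= k < n.+1) eta k).
  by rewrite /arithmetic_mean /= mulrCA ler_pM2l // invr_gt0.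
split => h n; last by rewrite E.
(* The mean at index [n] averages [n.+1] terms, so the empty sum is treated apart. *)
by case: n => [|n]; rewrite -?E // !big_geq // mulr0.
Qed.

Lemma nneseries_le (u : nat -> R) (M : R) : (forall i, 0 <= u i) ->
  (forall n, \sum_(0 <= k < n) u k <= M) -> (\sum_(0 <= i <oo) (u i)%:E <= M%:E)%E.
Proof.
move=> u0 uM; apply: lime_le; first by apply: is_cvg_nneseries => i _ _; rewrite lee_fin.
by apply: nearW => n; rewrite sumEFin lee_fin.
Qed.

Lemma nneseries_cvg (u : nat -> R) (l : R) : series u @ \oo --> l ->
  (\sum_(0 <= i <oo) (u i)%:E = l%:E)%E.
Proof.
move=> ul; apply/cvg_lim => //.
have -> : (fun n => \sum_(0 <= i < n) (u i)%:E)%E = EFin \o series u.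
  by apply/funext => n; rewrite /= sumEFin.
by apply: cvg_EFin => //; exact: nearW.
Qed.

Lemma ler_sum_subseq (I : eqType) (s t : seq I) (F : I -> R) : (forall i, 0 <= F i) ->
  uniq s -> uniq t -> {subset s <= t} -> \sum_(i <- s) F i <= \sum_(i <- t) F i.
Proof.
move=> F0 us ut st.
have /(perm_big _) -> : perm_eq s [seq i <- t | i \in s].
  apply: uniq_perm => //; first exact: filter_uniq.
  move=> i; rewrite mem_filter; have [/st ->|] := boolP (i \in s) => //.
rewrite big_filter big_mkcond; apply: ler_sum => i _; by case: ifP.
Qed.

Lemma sum_inj_le_nneseries (u : nat -> R) (sigma : nat -> nat) n (M : R) :
  (forall i, 0 <= u i) -> (\sum_(0 <= i <oo) (u i)%:E <= M%:E)%E -> injective sigma ->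
  \sum_(0 <= k < n) u (sigma k) <= M.
Proof.
move=> u0 uM si.
pose N := (\max_(k < n) (sigma k)).+1.
rewrite -lee_fin; apply: le_trans uM.
apply: (@le_trans _ _ (\sum_(0 <= i < N) (u i)%:E)%E); last first.
  by apply: nneseries_lim_ge => i _ _; rewrite lee_fin.
rewrite sumEFin lee_fin -(big_map sigma xpredT).
apply: ler_sum_subseq => //; rewrite ?map_inj_uniq ?iota_uniq //.
move=> i /mapP[k]; rewrite mem_index_iota => kn ->.
rewrite mem_index_iota /= ltnS.
exact: (@leq_bigmax _ (fun k : 'I_n => sigma k) (Ordinal kn)).
Qed.

Lemma sum_le_nneseries (u : nat -> R) n (M : R) :
  (forall i, 0 <= u i) -> (\sum_(0 <= i <oo) (u i)%:E <= M%:E)%E ->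
  \sum_(0 <= k < n) u k <= M.
Proof. by move=> u0 uM; exact: (@sum_inj_le_nneseries u id n M). Qed.

Lemma sum_bounded_cvg (u : nat -> R) (M : R) : (forall i, 0 <= u i) ->
  (forall n, \sum_(0 <= k < n) u k <= M) -> cvgn (series u).
Proof.
move=> u0 uM; apply: nondecreasing_is_cvgn.
  by apply/nondecreasing_seqP => n; rewrite /series /= big_nat_recr //= lerDl.
by exists M => _ [n _ <-]; exact: uM.
Qed.

(** * Substochastic matrices and majorization *)

Section Substochastic.
Variables (P : nat -> nat -> R) (xi : nat -> R).
Hypotheses (sP : substochastic P) (cx : co_star xi).

Let P0 i j : 0 <= P i j. Proof. by case: sP. Qed.
Let xi0 n : 0 <= xi n. Proof. by case: cx. Qed.
Let Px0 i j : 0 <= P i j * xi j. Proof. by rewrite mulr_ge0. Qed.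

Lemma row_partial_sum_le1 i n : \sum_(0 <= j < n) P i j <= 1.
Proof. by case: sP => _ r _; apply: sum_le_nneseries => //; exact: r. Qed.

Lemma apply_matrix_cvg i : series (fun j => P i j * xi j) @ \oo --> apply_matrix P xi i.
Proof.
apply: (@sum_bounded_cvg _ (xi 0%N)) => // n.
apply: (@le_trans _ _ (\sum_(0 <= j < n) P i j * xi 0%N)).
  by apply: ler_sum => j _; rewrite ler_wpM2l //; case: cx => _ + _; apply.
by rewrite -mulr_suml ler_piMl // row_partial_sum_le1.
Qed.

Lemma apply_matrix_ge n i : \sum_(0 <= j < n) P i j * xi j <= apply_matrix P xi i.
Proof.
apply: nondecreasing_cvgn_le; last by apply/cvg_ex; eexists; exact: apply_matrix_cvg.
by apply/nondecreasing_seqP => k; rewrite /series /= big_nat_recr //= lerDl.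
Qed.

Lemma apply_matrix_ge0 i : 0 <= apply_matrix P xi i.
Proof. by have := apply_matrix_ge 0 i; rewrite big_geq. Qed.

Lemma apply_matrix_le_tail N i :
  apply_matrix P xi i <= \sum_(0 <= j < N) P i j * xi j + xi N.
Proof.
apply: limr_le; first by apply/cvg_ex; eexists; exact: apply_matrix_cvg.
near=> n.
have -> : n = (N + (n - N))%N by rewrite subnKC //; near: n; exists N.
rewrite /series /= (big_cat_nat (n:=N)) ?leq_addr //= lerD2l.
apply: (@le_trans _ _ (\sum_(N <= j < N + (n - N)) P i j * xi N)).
  rewrite !big_seq; apply: ler_sum => j; rewrite mem_index_iota => /andP[Nj _].
  by rewrite ler_wpM2l //; case: cx => _ + _; apply.
rewrite -mulr_suml ler_piMl //; apply: le_trans (row_partial_sum_le1 i (N + (n - N))).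
by rewrite [leRHS](big_cat_nat (n:=N)) ?leq_addr //= lerDr sumr_ge0.
Unshelve. all: by end_near. Qed.

(** The columns from [N] on contribute at most [xi N] to every row, uniformly. Each of the first [N]
    columns has a convergent sum, so its entries tend to 0. *)
Lemma apply_matrix_cvg0 : apply_matrix P xi @ \oo --> (0 : R).
Proof.
apply/cvgrPdist_lt => e e0; have e2 : 0 < e / 2 by rewrite divr_gt0.
have [_ _ /cvgrPdist_lt /(_ _ e2) [N _ /(_ N (leqnn N)) /= xN]] := cx.
rewrite sub0r normrN ger0_norm // in xN.
have : \sum_(0 <= j < N) P i j * xi j @[i --> \oo] --> (0 : R).
  have {2}-> : (0 : R) = \sum_(0 <= j < N) 0 * xi j by rewrite big1 // => ? _; rewrite mul0r.
  apply: (cvg_big add_continuous) => j _; apply: cvgM; last exact: cvg_cst.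
  apply: cvg_series_cvg_0; apply: (@sum_bounded_cvg _ 1) => // n.
  by case: sP => _ _ c; apply: sum_le_nneseries => //; exact: c.
move=> /cvgrPdist_lt /(_ _ e2); apply: filterS => i.
rewrite !sub0r !normrN => h; rewrite ger0_norm ?apply_matrix_ge0 //.
apply: le_lt_trans (apply_matrix_le_tail N i) _; rewrite [e]splitr ltrD //.
by apply: le_lt_trans h; exact: ler_norm.
Qed.

(** Subtract the threshold [c = xi n]: the terms [w j * (xi j - c)] are at most [xi j - c] before
    [n] and nonpositive from [n] on, while the total weight costs at most [n * c]. *)
Lemma weighted_sum_le_initial (w : nat -> R) n N :
  (forall j, 0 <= w j <= 1) -> \sum_(0 <= j < n + N) w j <= n%:R ->
  \sum_(0 <= j < n + N) w j * xi j <= \sum_(0 <= j < n) xi j.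
Proof.
move=> w01 wn; set c := xi n.
have -> : \sum_(0 <= j < n + N) w j * xi j =
   \sum_(0 <= j < n + N) w j * (xi j - c) + (\sum_(0 <= j < n + N) w j) * c.
  by rewrite mulr_suml -big_split /=; apply: eq_bigr => j _; ring.
have -> : \sum_(0 <= j < n) xi j = \sum_(0 <= j < n) (xi j - c) + n%:R * c.
  by rewrite sumrB sumr_const_nat subn0 mulr_natl subrK.
apply: lerD; last by apply: ler_wpM2r; [exact: xi0|exact: wn].
rewrite (big_cat_nat (n:=n)) ?leq_addr //= -[leRHS]addr0; apply: lerD.
  rewrite !big_seq; apply: ler_sum => j; rewrite mem_index_iota => /andP[_ jn].
  have /andP[w0 w1] := w01 j; rewrite ler_piMl // subr_ge0.
  by case: cx => _ + _; apply; exact: ltnW.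
rewrite big_seq; apply: sumr_le0 => j; rewrite mem_index_iota => /andP[nj _].
have /andP[w0 w1] := w01 j; rewrite mulr_ge0_le0 // subr_le0.
by case: cx => _ + _; apply.
Qed.

(** Add up the [n] chosen rows. The resulting weight of each column is at most 1 since the rows are
    distinct, and the total weight is at most [n] by the row sums. *)
Lemma substochastic_majorization (sigma : nat -> nat) n : injective sigma ->
  \sum_(0 <= k < n) apply_matrix P xi (sigma k) <= \sum_(0 <= j < n) xi j.
Proof.
move=> si.
have : \sum_(0 <= k < n) series (fun j => P (sigma k) j * xi j) N @[N --> \oo] -->
   \sum_(0 <= k < n) apply_matrix P xi (sigma k).
  by apply: (cvg_big add_continuous) => k _; exact: apply_matrix_cvg.
move=> h; rewrite -(cvg_lim (@Rhausdorff R) h).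
apply: limr_le; first by apply/cvg_ex; eexists; exact: h.
near=> N.
have -> : N = (n + (N - n))%N by rewrite subnKC //; near: N; exists n.
rewrite /series /= exchange_big /=.
under eq_bigr do rewrite -mulr_suml.
apply: weighted_sum_le_initial.
  move=> j; rewrite sumr_ge0 //=; apply: (@sum_inj_le_nneseries (fun i => P i j)) => //.
  by case: sP => _ _; exact.
rewrite exchange_big /=; have -> : (n%:R : R) = \sum_(0 <= k < n) 1.
  by rewrite sumr_const_nat subn0.
by apply: ler_sum => k _; exact: row_partial_sum_le1.
Unshelve. all: by end_near. Qed.

Lemma substochastic_rearrangement :
  exists zeta, [/\ is_rearrangement (apply_matrix P xi) zeta
   & forall n, \sum_(0 <= k < n) zeta k <= \sum_(0 <= k < n) xi k].
Proof.
have [s gs] := greedy_exists apply_matrix_ge0 apply_matrix_cvg0.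
exists (apply_matrix P xi \o s); split.
  exact: greedy_rearrangement apply_matrix_ge0 apply_matrix_cvg0 gs.
by move=> n; apply: substochastic_majorization; exact: greedy_inj gs.
Qed.

End Substochastic.

(** * Finite and block Schur-Horn theorems *)

Section WeakHorn.
Variables (k : nat) (c s : R).

(* Rows of an orthogonal matrix: row 0 is [c e_k + s e_(k+1)], row [k+1] is
   [- s e_k + c e_(k+1)], and the other rows are the remaining basis vectors
   in order. *)
Let coefl (i : nat) : R := if i is m.+1 then (if m == k then - s else 1) else c.
Let coefr (i : nat) : R := if i is m.+1 then (if m == k then c else 0) else s.
Let posl (i : nat) : nat := if i is m.+1 then (if (k < m)%N then i else m) else k.

Definition givens_row (i j : nat) : R :=
  coefl i * (j == posl i)%:R + coefr i * (j == k.+1)%:R.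

Lemma sum_delta N p (F : nat -> R) : (p < N)%N ->
  \sum_(j < N) (nat_of_ord j == p)%:R * F j = F p.
Proof.
move=> pN; rewrite (bigD1 (Ordinal pN)) //= eqxx mul1r big1 ?addr0 // => j /eqP jp.
by rewrite (_ : (_ == _) = false) ?mul0r //; apply/eqP => e; apply: jp; apply: val_inj.
Qed.

Lemma sum_givens_row N i (F : nat -> R) : (k.+1 < N)%N -> (i < N)%N ->
  \sum_(j < N) givens_row i j * F j = coefl i * F (posl i) + coefr i * F k.+1.
Proof.
move=> kN iN; under eq_bigr do rewrite /givens_row mulrDl -!mulrA.
rewrite big_split /= -!mulr_sumr !sum_delta //.
by rewrite /posl; case: i iN => [|m] iN; [lia|case: ifP; lia].
Qed.

Hypothesis cs : c ^+ 2 + s ^+ 2 = 1.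

Definition givens_diag (F : nat -> R) m : R :=
  if (m < k)%N then F m else if m == k then s ^+ 2 * F k + c ^+ 2 * F k.+1 else F m.+1.

Lemma sum_givens_row00 N (F : nat -> R) : (k.+1 < N)%N ->
  \sum_(j < N) givens_row 0 j * (givens_row 0 j * F j) = c ^+ 2 * F k + s ^+ 2 * F k.+1.
Proof.
move=> kN; rewrite (@sum_givens_row N 0 (fun j => givens_row 0 j * F j)) //; last lia.
rewrite /givens_row /= !eqxx (_ : (k == k.+1) = false); last lia.
rewrite (_ : (k.+1 == k) = false); last lia.
by rewrite /=; ring.
Qed.

Lemma sum_givens_row0S N m (F : nat -> R) : (k.+1 < N)%N -> (m.+1 < N)%N ->
  \sum_(j < N) givens_row 0 j * (givens_row m.+1 j * F j) =
  (m == k)%:R * (c * s * (F k.+1 - F k)).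
Proof.
move=> kN mN; rewrite (@sum_givens_row N 0 (fun j => givens_row m.+1 j * F j)) //; last lia.
rewrite /givens_row /= eqxx (_ : (k == k.+1) = false); last lia.
have [->|mk] := eqVneq m k.
  rewrite ltnn eqxx (_ : (k.+1 == k) = false); last lia.
  by rewrite /=; ring.
case: (ltnP k m) => km /=.
  have -> : (k == m.+1) = false by lia.
  have -> : (k.+1 == m.+1) = false by lia.
  by rewrite /=; ring.
have -> : (k == m) = false by lia.
have -> : (k.+1 == m) = false by lia.
by rewrite /=; ring.
Qed.

Lemma sum_givens_rowSS N m m' (F : nat -> R) : (k.+1 < N)%N -> (m.+1 < N)%N ->
  (m'.+1 < N)%N ->
  \sum_(j < N) givens_row m.+1 j * (givens_row m'.+1 j * F j) =
  (m == m')%:R * givens_diag F m.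
Proof.
move=> kN mN m'N.
rewrite (@sum_givens_row N m.+1 (fun j => givens_row m'.+1 j * F j)) //.
rewrite /givens_row /givens_diag /= eqxx.
case: (ltngtP m k) => mk; case: (ltngtP m' k) => m'k; subst => /=.
all: rewrite ?eqxx ?eqSS ?[m == m']eq_sym /=.
all: repeat (match goal with |- context [(?a == ?b :> nat)] =>
   first [ rewrite (_ : (a == b) = false); [|by lia]
         | rewrite (_ : (a == b) = true); [|by lia] ] end).
all: rewrite /=; try by ring.
all: case: (m' == m); rewrite /=; ring.
Qed.

(** The product of the direct sum of the 1 by 1 identity and [Q'] with the matrix [U] of rows
    [givens_row]. *)
Definition givens_extend n (Q' : 'M[R]_n) : 'M[R]_n.+1 :=
  \matrix_(i, j) if unlift ord0 i is Some i' then
    \sum_(m < n) Q' i' m * givens_row m.+1 j else givens_row 0 j.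

Lemma givens_extend0 n (Q' : 'M[R]_n) j : givens_extend Q' ord0 j = givens_row 0 j.
Proof. by rewrite mxE unlift_none. Qed.

Lemma givens_extendS n (Q' : 'M[R]_n) i j :
  givens_extend Q' (lift ord0 i) j = \sum_(m < n) Q' i m * givens_row m.+1 j.
Proof. by rewrite mxE liftK. Qed.

(** Used twice: [F = 1] gives orthogonality of the rows, and [F = y] with [i = i'] gives the new
    diagonal. *)
Lemma sum_givens_extend n (Q' : 'M[R]_n) i i' (F : nat -> R) : (k < n)%N ->
  \sum_j givens_extend Q' (lift ord0 i) j * (givens_extend Q' (lift ord0 i') j * F j) =
  \sum_(m < n) Q' i m * Q' i' m * givens_diag F m.
Proof.
move=> kn; under eq_bigr => j _.
  rewrite !givens_extendS mulr_suml mulr_suml.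
  under eq_bigr => m _ do rewrite mulr_sumr.
  over.
rewrite exchange_big /=; apply: eq_bigr => m _; rewrite exchange_big /=.
have E (m' : 'I_n) : \sum_(j < n.+1) Q' i m * givens_row m.+1 j *
      (Q' i' m' * givens_row m'.+1 j * F j) =
    (nat_of_ord m' == m)%:R * (Q' i m * Q' i' m' * givens_diag F m).
  transitivity (Q' i m * Q' i' m' *
      \sum_(j < n.+1) givens_row m.+1 j * (givens_row m'.+1 j * F j)).
    by rewrite mulr_sumr; apply: eq_bigr => j _; ring.
  by rewrite sum_givens_rowSS ?ltnS // eq_sym; ring.
rewrite (eq_bigr _ (fun m' _ => E m')) (bigD1 m) //= eqxx mul1r big1 ?addr0 // => j jm.
by rewrite (_ : (_ == _) = false) ?mul0r //; apply/negbTE.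
Qed.

Lemma givens_extend_orthogonal n (Q' : 'M[R]_n) : (k < n)%N ->
  Q' *m Q'^T = 1%:M -> givens_extend Q' *m (givens_extend Q')^T = 1%:M.
Proof.
move=> kn QQ; apply/matrixP => i i'; rewrite [LHS]mxE [RHS]mxE.
have one m : givens_diag (fun=> 1) m = 1.
  by rewrite /givens_diag; do 2 case: ifP => // _; rewrite !mulr1 addrC.
have S0 i1 : \sum_j givens_extend Q' ord0 j * (givens_extend Q' (lift ord0 i1) j * 1) = 0.
  under eq_bigr => j _ do rewrite givens_extend0 givens_extendS mulr_suml mulr_sumr.
  rewrite exchange_big /= big1 // => m _.
  transitivity (Q' i1 m * \sum_(j < n.+1) givens_row 0 j * (givens_row m.+1 j * 1)).
    by rewrite mulr_sumr; apply: eq_bigr => j _; ring.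
  by rewrite (@sum_givens_row0S n.+1 m (fun=> 1)) ?ltnS // subrr !mulr0.
under eq_bigr do rewrite [X in _ * X]mxE -[X in _ * X]mulr1.
case: (unliftP ord0 i) => [i1|] ->; case: (unliftP ord0 i') => [i2|] ->.
- rewrite (@sum_givens_extend _ _ _ _ (fun=> 1)) //.
  under eq_bigr do rewrite one mulr1.
  move/matrixP : QQ => /(_ i1 i2); rewrite !mxE (inj_eq (@lift_inj _ ord0)) => <-.
  by apply: eq_bigr => m _; rewrite mxE.
- rewrite eq_sym (negbTE (neq_lift _ _)) -[RHS](S0 i1); apply: eq_bigr => j _; ring.
- by rewrite (negbTE (neq_lift _ _)) S0.
- under eq_bigr do rewrite givens_extend0.
  by rewrite (@sum_givens_row00 n.+1 (fun=> 1)) ?ltnS // !mulr1 eqxx cs.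
Qed.

End WeakHorn.

(* Schur-Horn with weak majorization: a plane rotation in the coordinates k, k+1
   with y_k >= x_0 > y_(k+1) produces the diagonal entry x_0, and the remaining
   diagonal still weakly majorizes the tail of x. *)
Lemma weak_horn n x y : nonincreasing_seq x -> nonincreasing_seq y ->
  (forall m, (m <= n)%N -> \sum_(0 <= i < m) x i <= \sum_(0 <= i < m) y i) ->
  exists2 Q : 'M[R]_n, Q *m Q^T = 1%:M & forall i : 'I_n, x i <= \sum_j Q i j ^+ 2 * y j.
Proof.
elim: n x y => [|n IH] x y xd yd xy.
  by exists 1%:M; [rewrite trmx1 mulmx1|case].
(* If the largest [x] is below the smallest [y], the identity already works. *)
have [xyn|ynx] := leP (x 0%N) (y n).
  exists 1%:M; first by rewrite trmx1 mulmx1.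
  move=> i; rewrite (bigD1 i) //= big1 => [|j ji].
    rewrite mxE eqxx expr1n mul1r addr0.
    apply: le_trans (xd 0%N i _) (le_trans xyn (yd i n _)) => //.
    by rewrite -ltnS.
  by rewrite mxE eq_sym (negbTE ji) expr0n mul0r.
have exK : exists m, y m < x 0%N by exists n.
case: (ex_minnP exK) => K ylt Kmin.
have K0 : K != 0%N.
  apply/eqP => K0; have := xy 1%N isT; rewrite !big_nat1 leNgt => /negP; apply.
  by move: ylt; rewrite K0.
have [k Kk] : exists k, K = k.+1 by exists K.-1; rewrite prednK // lt0n.
rewrite {K K0}Kk in ylt Kmin.
have xyk : x 0%N <= y k by rewrite leNgt; apply/negP => /Kmin; rewrite ltnn.
have kn : (k < n)%N by exact: Kmin.
have ykk : 0 < y k - y k.+1 by rewrite subr_gt0; exact: lt_le_trans ylt xyk.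
(* The weight solving [t * y k + (1 - t) * y k.+1 = x 0]; it is the squared cosine of the
   rotation. *)
pose t := (x 0%N - y k.+1) / (y k - y k.+1).
have t0 : 0 <= t by apply: divr_ge0; [rewrite subr_ge0 ltW|exact: ltW].
have t1 : 0 <= 1 - t by rewrite subr_ge0 ler_pdivrMr // mul1r lerD2r.
have tE : t * (y k - y k.+1) = x 0%N - y k.+1 by rewrite divfK // gt_eqF.
pose c := Num.sqrt t; pose s := Num.sqrt (1 - t).
have c2 : c ^+ 2 = t by rewrite sqr_sqrtr.
have s2 : s ^+ 2 = 1 - t by rewrite sqr_sqrtr.
pose y' := givens_diag k c s y.
have y'k : y' k = y k + y k.+1 - x 0%N.
  by rewrite /y' /givens_diag ltnn eqxx c2 s2; move: tE; lra.
have y'l m : (m < k)%N -> y' m = y m by rewrite /y' /givens_diag => ->.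
have y'r m : (k < m)%N -> y' m = y m.+1.
  by move=> km; rewrite /y' /givens_diag ltnNge (ltnW km) /= gtn_eqF.
have y'S m : (k < m)%N -> \sum_(0 <= i < m) y' i = \sum_(0 <= i < m.+1) y i - x 0%N.
  elim: m => // m IHm; rewrite ltnS leq_eqVlt => /orP[/eqP <-|km].
    rewrite !big_nat_recr //= y'k (eq_big_nat _ _ (F2 := y)) => [|i /andP[_ ik]].
      by ring.
    exact: y'l.
  by rewrite big_nat_recr //= IHm // [in RHS]big_nat_recr //= y'r //; ring.
have y'd : nonincreasing_seq y'.
  apply/nonincreasing_seqP => m.
  have ym := yd m m.+1 (leqnSn _); have ym1 := yd m.+1 m.+2 (leqnSn _).
  have [mk|mk|mk] := ltngtP m.+1 k.
  - by rewrite !y'l //; lia.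
  - have [mk'|mk'] := leqP m.+1 k; first by lia.
    have [e|e] := eqVneq m k.
      by rewrite y'r // e y'k; rewrite e in ym1; move: ym1 xyk; lra.
    by rewrite !y'r //; lia.
  - by rewrite mk y'k y'l -?mk //; move: ylt ym; rewrite -mk; lra.
(* Up to [k] the inequality is termwise, since [x i.+1 <= x 0 <= y k <= y i]. Past [k] the rotation
   has preserved the trace, so removing [x 0] from both sides leaves the hypothesis at [m.+1]. *)
have xy' m : (m <= n)%N -> \sum_(0 <= i < m) x i.+1 <= \sum_(0 <= i < m) y' i.
  move=> mn; have [mk|km] := leqP m k.
    rewrite !big_nat; apply: ler_sum => i /andP[_ im].
    rewrite y'l; last by lia.
    apply: le_trans (xd 0%N i.+1 _) (le_trans xyk (yd i k _)) => //; lia.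
  by have := xy m.+1 mn; rewrite y'S // lerBrDl big_nat_recl.
have [Q' QQ Qx] := IH (fun i => x i.+1) y' (fun i j ij => xd i.+1 j.+1 ij) y'd xy'.
have cs1 : c ^+ 2 + s ^+ 2 = 1 by rewrite c2 s2; ring.
exists (givens_extend k c s Q'); first exact: givens_extend_orthogonal.
move=> i; under eq_bigr do rewrite expr2 -mulrA.
case: (unliftP ord0 i) => [i'|] ->; last first.
  under eq_bigr do rewrite givens_extend0.
  by rewrite sum_givens_row00 // c2 s2 /=; move: tE; lra.
rewrite sum_givens_extend //; apply: le_trans (Qx i') _.
by apply: ler_sum => m _; rewrite -expr2.
Qed.

(** * Direct sums of finite blocks *)

Section Blocks.
Variable b : nat -> nat.
Hypotheses (b0 : b 0%N = 0%N) (bS : forall k, (b k < b k.+1)%N).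

Lemma block_cover i : exists k, (b k <= i < b k.+1)%N.
Proof.
have bk k : (k <= b k)%N by elim: k => // k IH; exact: leq_ltn_trans (bS k).
have ex : exists k, (i < b k.+1)%N by exists i; exact: bk.
case: (ex_minnP ex) => -[|k] ik kmin; first by exists 0%N; rewrite b0.
by exists k.+1; rewrite ik andbT leqNgt; apply/negP => /kmin; rewrite ltnn.
Qed.

Lemma block_uniq i k l : (b k <= i < b k.+1)%N -> (b l <= i < b l.+1)%N -> k = l.
Proof.
clear b0; have mb : {homo b : m n / (m <= n)%N}.
  by apply: homo_leq => //; [exact: leq_trans|move=> n; exact: ltnW].
have [kl|kl|//] := ltngtP k l.
  have := mb _ _ kl; lia.
have := mb _ _ kl; lia.
Qed.

Lemma sum_block (T : nmodType) k n (G : nat -> T) : (b k.+1 <= n)%N ->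
  (forall j, ~~ (b k <= j < b k.+1)%N -> G j = 0) ->
  \sum_(0 <= j < n) G j = \sum_(j < b k.+1 - b k) G (b k + j)%N.
Proof.
clear b0; move=> kn G0; rewrite (big_cat_nat (n := b k)) //=; last by have := bS k; lia.
rewrite big_nat big1 => [|j /andP[_ jk]]; last by apply: G0; lia.
rewrite add0r (big_cat_nat (n := b k.+1)) //=; last by have := bS k; lia.
rewrite [X in _ + X]big_nat [X in _ + X]big1 => [|j /andP[jk _]]; last by apply: G0; lia.
rewrite addr0 -{1}[b k]add0n big_addn big_mkord.
by apply: eq_bigr => j _; rewrite addnC.
Qed.

End Blocks.

Lemma direct_sum_of_imply (T : nmodType) (K K' : forall n, 'M[T]_n -> Prop)
    (A : nat -> nat -> T) : (forall n B, K n B -> K' n B) ->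
  direct_sum_of K A -> direct_sum_of K' A.
Proof. by move=> KK' [b [b0 bS bK bA]]; exists b; split=> // k; exact/KK'/bK. Qed.

Lemma direct_sum_of_map (T T' : nmodType) (K : forall n, 'M[T]_n -> Prop)
    (K' : forall n, 'M[T']_n -> Prop) (f : T -> T') (A : nat -> nat -> T) : f 0 = 0 ->
  (forall n B, K n B -> K' n (map_mx f B)) ->
  direct_sum_of K A -> direct_sum_of K' (fun i j => f (A i j)).
Proof.
move=> f0 KK' [b [b0 bS bK bA]]; exists b; split=> // [k|i j]; last first.
  by move=> fA; apply: bA; apply: contraNneq fA => ->; rewrite f0.
have -> : \matrix_(i, j) f (A (b k + i)%N (b k + j)%N) =
  map_mx f (\matrix_(i < b k.+1 - b k, j < b k.+1 - b k) A (b k + i)%N (b k + j)%N).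
  by apply/matrixP => i j; rewrite !mxE.
exact/KK'/bK.
Qed.

Lemma direct_sum_of_tr (T : nmodType) (K : forall n, 'M[T]_n -> Prop)
    (A : nat -> nat -> T) :
  direct_sum_of K A -> direct_sum_of (fun n B => K n B^T) (fun i j => A j i).
Proof.
move=> [b [b0 bS bK bA]]; exists b; split=> // [k|i j /bA[k []]]; last by exists k.
have -> : (\matrix_(i, j) A (b k + j)%N (b k + i)%N)^T =
  \matrix_(i < b k.+1 - b k, j < b k.+1 - b k) A (b k + i)%N (b k + j)%N.
  by apply/matrixP => i j; rewrite !mxE.
exact: bK.
Qed.

(** Rows have finite support, so the infinite Gram sums become eventually constant partial sums;
    rows from different blocks have disjoint supports. *)
Lemma direct_sum_row_gram (T : comPzRingType) (A : nat -> nat -> T) :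
  direct_sum_of (fun n (B : 'M[T]_n) => B *m B^T = 1%:M) A -> forall i i',
  exists N, forall n, (N <= n)%N -> \sum_(0 <= j < n) A i j * A i' j = (i == i')%:R.
Proof.
move=> [b [b0 bS bK bA]] i i'; have [k ik] := block_cover b0 bS i.
have [k' ik'] := block_cover b0 bS i'.
exists (b k.+1) => n kn.
have A0 j : ~~ (b k <= j < b k.+1)%N -> A i j = 0.
  apply: contraNeq => /bA [l [il jl]]; by rewrite (block_uniq bS ik il).
rewrite (sum_block bS kn) => [|j /A0 ->]; last by rewrite mul0r.
have [kk|kk] := eqVneq k k'; last first.
  rewrite (_ : (i == i') = false); last first.
    by apply: contraNF kk => /eqP ii; rewrite -ii in ik'; rewrite (block_uniq bS ik ik').
  rewrite big1 // => j _; suff -> : A i' (b k + j)%N = 0 by rewrite mulr0.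
  apply: contraNeq kk => /bA[l [il jl]]; rewrite (block_uniq bS ik' il).
  by apply/eqP/(block_uniq bS _ jl); have := ltn_ord j; lia.
rewrite -kk in ik'.
have iI : (i - b k < b k.+1 - b k)%N by lia.
have iI' : (i' - b k < b k.+1 - b k)%N by lia.
have /matrixP/(_ (Ordinal iI) (Ordinal iI')) := bK k; rewrite !mxE.
have -> : (Ordinal iI == Ordinal iI') = (i == i') by rewrite -val_eqE /=; lia.
move=> <-; apply: eq_bigr => j _; rewrite !mxE /= !subnKC //; lia.
Qed.

Lemma direct_sum_of_support (T : nmodType) (K : forall n, 'M[T]_n -> Prop)
    (A : nat -> nat -> T) i : direct_sum_of K A ->
  exists N, forall j, (N <= j)%N -> A i j = 0.
Proof.
move=> [b [b0 bS bK bA]]; have [k ik] := block_cover b0 bS i.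
exists (b k.+1) => j kj; apply: contraPeq kj => /bA[l [il jl]].
by rewrite (block_uniq bS ik il); lia.
Qed.

(** The blocks enter as functions on [nat], which avoids a family of matrices whose type depends on
    [k]. *)
Lemma direct_sum_of_blocks (T : nmodType) (K : forall n, 'M[T]_n -> Prop)
    (b : nat -> nat) (q : nat -> nat -> nat -> T) : b 0%N = 0%N ->
  (forall k, (b k < b k.+1)%N) ->
  (forall k, K (b k.+1 - b k)%N (\matrix_(i, j) q k i j)) ->
  exists A, [/\ direct_sum_of K A,
    forall k (i j : 'I_(b k.+1 - b k)), A (b k + i)%N (b k + j)%N = q k i j
    & forall k i j, (b k <= i < b k.+1)%N -> ~~ (b k <= j < b k.+1)%N -> A i j = 0].
Proof.
move=> b0 bS Kq; have /choice [blk blkP] := block_cover b0 bS.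
pose A i j := if blk i == blk j then q (blk i) (i - b (blk i))%N (j - b (blk i))%N else 0.
have blkE k (i : 'I_(b k.+1 - b k)) : blk (b k + i)%N = k.
  by apply: (block_uniq bS (blkP _)); have := ltn_ord i; lia.
have AE k (i j : 'I_(b k.+1 - b k)) : A (b k + i)%N (b k + j)%N = q k i j.
  by rewrite /A !blkE eqxx !addKn.
have A0 i j : A i j != 0 -> blk i = blk j.
  by rewrite /A; case: ifP => [/eqP//|_]; rewrite eqxx.
exists A; split => // [|k i j ik]; last first.
  apply: contraNeq => /A0 e; rewrite (block_uniq bS ik (blkP i)) e; exact: blkP.
exists b; split => // [k|i j /A0 e]; last first.
  by exists (blk i); split; [exact: blkP|rewrite e; exact: blkP].
have -> : \matrix_(i, j) A (b k + i)%N (b k + j)%N =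
  \matrix_(i < b k.+1 - b k, j < b k.+1 - b k) q k i j.
  by apply/matrixP => i j; rewrite !mxE AE.
exact: Kq.
Qed.

Lemma block_stochastic_row_sum P i : block_stochastic P -> row_sum P i = 1%E.
Proof.
move=> [b [b0 bS bK bA]]; have [k ik] := block_cover b0 bS i.
apply: nneseries_cvg; apply: cvg_near_cst; near=> n.
have kn : (b k.+1 <= n)%N by near: n; exists (b k.+1).
rewrite /series /= (sum_block bS kn) => [|j]; last first.
  by apply: contraNeq => /bA[l [il jl]]; rewrite (block_uniq bS ik il).
have iI : (i - b k < b k.+1 - b k)%N by lia.
have [_ /(_ (Ordinal iI)) <- _] := bK k.
by apply: eq_bigr => j _; rewrite mxE /= subnKC //; lia.
Unshelve. all: by end_near. Qed.

Lemma block_stochastic_tr P : block_stochastic P -> block_stochastic (fun i j => P j i).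
Proof.
move=> /direct_sum_of_tr; apply: direct_sum_of_imply => n B [B0 Br Bc].
split => [i j|i|j]; first by have := B0 j i; rewrite mxE.
  by rewrite -[RHS](Bc i); apply: eq_bigr => j _; rewrite mxE.
by rewrite -[RHS](Br j); apply: eq_bigr => i _; rewrite mxE.
Qed.

Lemma direct_sum_of_entry (T : nmodType) (K : forall n, 'M[T]_n -> Prop) (p : T -> Prop)
    (A : nat -> nat -> T) : p 0 -> (forall n B, K n B -> forall i j, p (B i j)) ->
  direct_sum_of K A -> forall i j, p (A i j).
Proof.
move=> p0 pK [b [_ _ bK bA]] i j; have [->//|/bA[k [ik jk]]] := eqVneq (A i j) 0.
have iI : (i - b k < b k.+1 - b k)%N by lia.
have jI : (j - b k < b k.+1 - b k)%N by lia.
have := pK _ _ (bK k) (Ordinal iI) (Ordinal jI); rewrite mxE /= !subnKC //; lia.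
Qed.

Lemma block_stochastic_substochastic P : block_stochastic P -> substochastic P.
Proof.
move=> bP; split => [i j|i|j].
- apply: (direct_sum_of_entry (p := fun r => 0 <= r) _ _ bP i j) => // n B [] //.
- by rewrite block_stochastic_row_sum.
- have := block_stochastic_row_sum j (block_stochastic_tr bP).
  by rewrite /row_sum /col_sum => ->.
Qed.

(** The cut after [n] is a minimizer of [d] over all indices beyond [n]; it exists because [d] tends
    to infinity. *)
Lemma block_points (d : nat -> R) : (forall m, d 0%N <= d m) -> d @ \oo --> +oo ->
  exists b : nat -> nat, [/\ b 0%N = 0%N, forall k, (b k < b k.+1)%N
    & forall k m, (b k <= m)%N -> d (b k) <= d m].
Proof.
move=> d0 doo.
have step n : exists n', (n < n')%N /\ forall m, (n' <= m)%N -> d n' <= d m.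
  have /cvgryPge /(_ (d n.+1)) [N _ Nd] := doo.
  (* The range contains the competitor [n.+1], and every index outside it has [d] at least
     [d n.+1]. *)
  pose B := (N + n.+2)%N; have nB : (n.+1 < B)%N by rewrite /B; lia.
  case: (@arg_minP _ _ _ (Ordinal nB) (fun i : 'I_B => (n < i)%N) (fun i => d i)).
    by [].
  move=> j nj jmin; exists (j : nat); split => // m jm.
  have [mB|Bm] := ltnP m B; first by apply: (jmin (Ordinal mB)) => /=; lia.
  apply: le_trans (jmin (Ordinal nB) _) _ => //=; apply: Nd => /=; rewrite /B in Bm; lia.
have [f fP] := choice step; exists (fun k => iter k f 0%N); split => //.
  by move=> k; rewrite iterS; case: (fP (iter k f 0%N)).
by case=> [|k] m // km; rewrite iterS; case: (fP (iter k f 0%N)) => _; apply.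
Qed.

(* The factor 2 makes the gap between the partial sums tend to infinity, so that
   2 M eta weakly majorizes xi on the blocks cut out by its successive minima. *)
Lemma nonsummable_block_majorization (xi eta : nat -> R) (M : R) :
  co_star xi -> co_star eta -> 0 < M -> ~ cvgn (series xi) ->
  (forall n, \sum_(0 <= i < n) xi i <= M * \sum_(0 <= i < n) eta i) ->
  exists A : nat -> nat -> R,
    direct_sum_of (fun n (B : 'M[R]_n) => B *m B^T = 1%:M) A /\
    forall i, exists N, forall n, (N <= n)%N ->
      xi i <= 2 * M * \sum_(0 <= j < n) A i j ^+ 2 * eta j.
Proof.
move=> cx ce M0 ncx xe.
have x0 i : 0 <= xi i by case: cx.
pose y i := 2 * M * eta i.
have yE n : \sum_(0 <= i < n) y i = 2 * M * \sum_(0 <= i < n) eta i by rewrite mulr_sumr.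
have yd : nonincreasing_seq y.
  move=> m n mn; apply: ler_wpM2l; first by rewrite mulr_ge0 // ltW.
  by case: ce => _ + _; apply.
pose d n := \sum_(0 <= i < n) (y i - xi i).
(* One half of [y] pays for [xi] by hypothesis; the other half leaves a gap at least the partial sum
   of [xi], which diverges. *)
have dx n : series xi n <= d n.
  rewrite /d sumrB yE; have := xe n; rewrite /series /=; lra.
have sx n : 0 <= series xi n by rewrite /series /= sumr_ge0.
have doo : d @ \oo --> +oo.
  have : series xi @ \oo --> +oo.
    apply: nondecreasing_dvgn_lt ncx; apply/nondecreasing_seqP => n.
    by rewrite /series /= big_nat_recr //= lerDl.
  move=> /cvgryPge h; apply/cvgryPge => z; have := h z; apply: filterS => n zn.
  exact: le_trans zn (dx n).
have d0 m : d 0%N <= d m.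
  by rewrite {1}/d big_geq //; exact: le_trans (sx m) (dx m).
have [b [b0 bS bd]] := block_points d0 doo.
have H k : exists q : nat -> nat -> R, let n := (b k.+1 - b k)%N in
    let B := \matrix_(i < n, j < n) q i j in B *m B^T = 1%:M /\
    forall i : 'I_n, xi (b k + i)%N <= \sum_j B i j ^+ 2 * y (b k + j)%N.
  have [|||Q QQ Qx] := @weak_horn (b k.+1 - b k) (fun i => xi (b k + i)%N)
     (fun i => y (b k + i)%N).
  - by move=> m n mn; case: cx => _ + _; apply; lia.
  - by move=> m n mn; apply: yd; lia.
  (* Weak majorization inside block [k] says exactly that [d] is at least [d (b k)] there. *)
  - move=> m mn; have := bd k (b k + m)%N (leq_addr _ _).
    rewrite /d [leRHS](big_cat_nat (n := b k)) ?leq_addr //= lerDl.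
    have E (F : nat -> R) : \sum_(b k <= j < b k + m) F j = \sum_(0 <= j < m) F (b k + j)%N.
      by rewrite -{1}[b k]add0n big_addn addKn; apply: eq_bigr => j _; rewrite addnC.
    by rewrite sumrB subr_ge0 !E.
  exists (fun i j => if insub i is Some i' then if insub j is Some j' then Q i' j' else 0
     else 0).
  move=> n B; have -> : B = Q by apply/matrixP => i j; rewrite mxE !valK.
  by split.
have [q qP] := choice H.
have [A [dA AE A0]] := @direct_sum_of_blocks _
  (fun n (B : 'M[R]_n) => B *m B^T = 1%:M) b q b0 bS (fun k => (qP k).1).
exists A; split => // i; have [k ik] := block_cover b0 bS i.
have [_ qx] := qP k; exists (b k.+1) => n kn.
have iI : (i - b k < b k.+1 - b k)%N by lia.
have := qx (Ordinal iI); rewrite /= subnKC; last by lia.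
move=> /le_trans; apply; rewrite mulr_sumr.
rewrite (sum_block bS kn) => [|j jk]; last first.
  by rewrite (A0 k) // expr0n mul0r mulr0.
apply: ler_sum => j _; rewrite mxE /= /y -(AE k (Ordinal iI)) /= subnKC; last by lia.
by rewrite mulrCA.
Qed.

End Sequences.

(** * Operators on a Hilbert space *)

Section Hilbert.
Context {R : realType} {H : completeNormedModType R[i]}.
Variable dot : {dot H for conjC}.
Hypothesis hdot : hilbert_inner_product dot.
Local Notation C := R[i].
Implicit Types (x y : H) (f g : nat -> H) (a c : nat -> C) (s : nat -> R).
Implicit Types (X Y T : {linear H -> H}).

Lemma dotC x y : dot x y = (dot y x)^*%R.
Proof. by rewrite hermC /= expr0 mul1r. Qed.

Lemma dotDl x y z : dot (x + y) z = dot x z + dot y z. Proof. exact: linearDl. Qed.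
Lemma dotBl x y z : dot (x - y) z = dot x z - dot y z. Proof. exact: linearBl. Qed.
Lemma dotDr x y z : dot z (x + y) = dot z x + dot z y. Proof. exact: linearDr. Qed.
Lemma dotBr x y z : dot z (x - y) = dot z x - dot z y. Proof. exact: linearBr. Qed.
Lemma dotZl (k : C) x y : dot (k *: x) y = k * dot x y. Proof. exact: linearZl_LR. Qed.
Lemma dotZr (k : C) x y : dot x (k *: y) = k^*%R * dot x y. Proof. exact: linearZr_LR. Qed.
Lemma dot0l x : dot 0 x = 0. Proof. exact: linear0l. Qed.
Lemma dot0r x : dot x 0 = 0. Proof. exact: linear0r. Qed.
Lemma dot_suml I (r : seq I) (F : I -> H) x :
  dot (\sum_(i <- r) F i) x = \sum_(i <- r) dot (F i) x.
Proof. exact: linear_sumlz. Qed.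
Lemma dot_sumr I (r : seq I) (F : I -> H) x :
  dot x (\sum_(i <- r) F i) = \sum_(i <- r) dot x (F i).
Proof. exact: linear_sumr. Qed.

Lemma normsqB x y : `|x - y| ^+ 2 = `|x| ^+ 2 + `|y| ^+ 2 - (dot x y + dot y x).
Proof. by rewrite !hdot dotBl !dotBr; ring. Qed.

Lemma normsqD x y : `|x + y| ^+ 2 = `|x| ^+ 2 + `|y| ^+ 2 + (dot x y + dot y x).
Proof. by rewrite !hdot dotDl !dotDr; ring. Qed.

Lemma parallelogram x y : `|x + y| ^+ 2 + `|x - y| ^+ 2 = 2 * (`|x| ^+ 2 + `|y| ^+ 2).
Proof. by rewrite normsqB normsqD; ring. Qed.

Lemma dot_inj x y : (forall z, dot z x = dot z y) -> x = y.
Proof.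
move=> h; apply/eqP; rewrite -subr_eq0 -normr_eq0 -sqrf_eq0 hdot dotBr h subrr.
exact: eqxx.
Qed.

Lemma cauchy_schwarz x y : `|dot x y| <= `|x| * `|y|.
Proof.
have [->|y0] := eqVneq y 0; first by rewrite dot0r !normr0 mulr0.
have ny : 0 < `|y| by rewrite normr_gt0.
pose k := dot x y / `|y| ^+ 2.
have : 0 <= `|x - k *: y| ^+ 2 by rewrite exprn_ge0.
have -> : `|x - k *: y| ^+ 2 = `|x| ^+ 2 - `|dot x y| ^+ 2 / `|y| ^+ 2.
  have kC : k^*%R = (dot x y)^*%R / `|y| ^+ 2.
    have n2 : (`|y| ^+ 2)^*%R = `|y| ^+ 2 by apply/CrealP; rewrite ger0_real // exprn_ge0.
    by rewrite /k rmorphM fmorphV /= n2.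
  rewrite hdot dotBl !dotBr !dotZl !dotZr kC (dotC y x) -!hdot /k normCK.
  by field; rewrite gt_eqF.
rewrite subr_ge0 ler_pdivrMr ?exprn_gt0 // -exprMn.
by rewrite ler_pXn2r // nnegrE ?mulr_ge0.
Qed.

Lemma cvg_dotl (I : Type) (F : set_system I) (u : I -> H) x y : Filter F ->
  u @ F --> x -> dot (u n) y @[n --> F] --> dot x y.
Proof.
move=> FF Fx; apply/cvgrPdist_lt => e e0.
have y1 : 0 < `|y| + 1 by rewrite ltr_wpDl.
have /cvgrPdist_lt/(_ _ (divr_gt0 e0 y1)) := Fx; apply: filterS => z zx.
rewrite -dotBl; apply: le_lt_trans (cauchy_schwarz _ _) _.
rewrite ltr_pdivlMr // in zx; apply: le_lt_trans zx.
by rewrite ler_wpM2l // lerDl.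
Qed.

Lemma cvg_dotr (I : Type) (F : set_system I) (u : I -> H) x y : Filter F ->
  u @ F --> x -> dot y (u n) @[n --> F] --> dot y x.
Proof.
move=> FF Fx; apply/cvgrPdist_lt => e e0.
have /cvgrPdist_lt/(_ _ e0) := cvg_dotl (y := y) FF Fx; apply: filterS => z zx.
by rewrite dotC (dotC y) -rmorphB /= norm_conjC.
Qed.

Lemma Hcvg_unique (F : set_system H) x y : ProperFilter F -> F --> x -> F --> y -> x = y.
Proof. by move=> FF; exact: (@norm_cvg_unique _ _ F). Qed.

(** * Orthonormal systems and Schmidt series *)

(** Orthonormal except that zero vectors are allowed: these fill up the singular systems of
    finite-rank operators, so that all systems are indexed by [nat]. *)
Definition orthosys g := forall i j, dot (g i) (g j) = ((i == j) && (g i != 0))%:R.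

Section Orthosys.
Variable g : nat -> H.
Hypothesis og : orthosys g.

Lemma orthosys_neq i j : i != j -> dot (g i) (g j) = 0.
Proof. by move=> ij; rewrite og (negbTE ij). Qed.

Lemma orthosys_norm i : g i != 0 -> dot (g i) (g i) = 1.
Proof. by rewrite og eqxx => ->. Qed.

Lemma orthosys_le1 i : `|g i| <= 1.
Proof.
rewrite -(@ler_pXn2r _ 2) ?nnegrE // expr1n hdot og eqxx; by case: (_ != _) => //=.
Qed.

Lemma dot_orthosys_sum (r : seq nat) c j : uniq r ->
  dot (\sum_(i <- r) c i *: g i) (g j) = ((j \in r) && (g j != 0))%:R * c j.
Proof.
move=> ur; rewrite dot_suml; have [jr|jr] := boolP (j \in r); last first.
  rewrite mul0r big_seq big1 // => i ir; rewrite dotZl orthosys_neq ?mulr0 //.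
  by apply: contraNneq jr => <-.
rewrite (bigD1_seq j) //= big1 ?addr0 => [|i ij]; last first.
  by rewrite dotZl orthosys_neq ?mulr0.
by rewrite dotZl og eqxx mulrC.
Qed.

Lemma normsq_orthosys_sum (r : seq nat) c : uniq r ->
  `|\sum_(i <- r) c i *: g i| ^+ 2 = \sum_(i <- r) (g i != 0)%:R * `|c i| ^+ 2.
Proof.
move=> ur; rewrite hdot dot_sumr; apply: eq_big_seq => i ir.
by rewrite dotZr dot_orthosys_sum // ir /= normCK; ring.
Qed.

Lemma normsq_orthosys_sum_le (r : seq nat) c : uniq r ->
  `|\sum_(i <- r) c i *: g i| ^+ 2 <= \sum_(i <- r) `|c i| ^+ 2.
Proof.
move=> ur; rewrite normsq_orthosys_sum //; apply: ler_sum => i _.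
by case: (_ != _); rewrite ?mul1r ?mul0r ?exprn_ge0.
Qed.

Lemma normsq_sub_projection (r : seq nat) x : uniq r ->
  `|x - \sum_(i <- r) dot x (g i) *: g i| ^+ 2 =
  `|x| ^+ 2 - \sum_(i <- r) `|dot x (g i)| ^+ 2.
Proof.
move=> ur; rewrite normsqB normsq_orthosys_sum //.
have e1 : \sum_(i <- r) (g i != 0)%:R * `|dot x (g i)| ^+ 2 =
    \sum_(i <- r) `|dot x (g i)| ^+ 2.
  apply: eq_bigr => i _; have [->|_] := eqVneq (g i) 0; last by rewrite mul1r.
  by rewrite dot0r normr0 expr0n mul0r.
have e2 : dot x (\sum_(i <- r) dot x (g i) *: g i) = \sum_(i <- r) `|dot x (g i)| ^+ 2.
  by rewrite dot_sumr; apply: eq_bigr => i _; rewrite dotZr normCK mulrC.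
have e3 : dot (\sum_(i <- r) dot x (g i) *: g i) x = \sum_(i <- r) `|dot x (g i)| ^+ 2.
  rewrite dotC e2 rmorph_sum; apply: eq_bigr => i _.
  by rewrite /= rmorphXn /= conj_normC.
by rewrite e1 e2 e3; ring.
Qed.

Lemma bessel (r : seq nat) x : uniq r ->
  \sum_(i <- r) `|dot x (g i)| ^+ 2 <= `|x| ^+ 2.
Proof. by move=> ur; rewrite -subr_ge0 -normsq_sub_projection // exprn_ge0. Qed.

End Orthosys.

Lemma num_cvg_unique (K : numFieldType) (I : Type) (F : set_system I) (u : I -> K)
    (l m : K) : ProperFilter F -> u @ F --> l -> u @ F --> m -> l = m.
Proof. by move=> FF; exact: (@norm_cvg_unique _ K^o (u @ F)). Qed.

Lemma cvg_eventually_cst (K : numFieldType) (u : nat -> K) N (l m : K) :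
  (forall n, (N <= n)%N -> u n = m) -> u @ \oo --> l -> l = m.
Proof.
move=> um ul; apply: (num_cvg_unique (F := \oo) _ ul).
by apply: cvg_near_cst; near=> n; apply: um; near: n; exists N.
Unshelve. all: by end_near. Qed.

Lemma complex_gt0E (e : C) : 0 < e -> exists2 r : R, 0 < r & e = r%:C.
Proof.
move=> e0; have er : e \is Num.real by rewrite realE ltW.
by exists (complex.Re e); rewrite ?RRe_real // -ltcR RRe_real.
Qed.

Lemma complex_ge0E (e : C) : 0 <= e -> exists2 r : R, 0 <= r & e = r%:C.
Proof.
move=> e0; have er : e \is Num.real by rewrite realE e0.
by exists (complex.Re e); rewrite ?RRe_real // -lecR RRe_real.
Qed.

Lemma norm_le_eps (x : H) (B : C) : 0 <= B ->
  (forall e : C, 0 < e -> `|x| <= B + e) -> `|x| <= B.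
Proof.
move=> B0 h; rewrite real_leNgt ?realE ?normr_ge0 ?B0 //; apply/negP => Bx.
have e0 : 0 < (`|x| - B) / 2 by rewrite divr_gt0 // subr_gt0.
by have := h _ e0; rewrite -lerBlDl {1}[_ - B]splitr gerDl => /le_gtF; rewrite e0.
Qed.

Lemma norm_lim_le (I : Type) (F : set_system I) (u : I -> H) x (B : C) : ProperFilter F ->
  0 <= B -> u @ F --> x -> (\forall n \near F, `|u n| <= B) -> `|x| <= B.
Proof.
move=> FF B0 ux uB; apply: norm_le_eps => // e e0.
have /cvgrPdist_lt/(_ _ e0) ue := ux.
have [n [nB ne]] := filter_ex (filterI uB ue).
by rewrite -(subrK (u n) x) addrC (le_trans (ler_normD _ _)) // lerD // ltW.
Qed.

Definition sqn (z : C) : R := complex.Re z ^+ 2 + complex.Im z ^+ 2.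

Lemma sqnE z : (sqn z)%:C = `|z| ^+ 2. Proof. exact: add_Re2_Im2. Qed.

Lemma sqn_ge0 z : 0 <= sqn z. Proof. by rewrite addr_ge0 ?sqr_ge0. Qed.

Lemma sum_sqnE m n c : (\sum_(m <= i < n) sqn (c i))%:C = \sum_(m <= i < n) `|c i| ^+ 2.
Proof. by rewrite rmorph_sum; apply: eq_bigr => i _; exact: sqnE. Qed.

(** Riesz-Fischer: by Pythagoras the Cauchy condition for the squared coefficients is inherited by
    the vectors, and [H] is complete. *)
Lemma orthosys_series_cvg g c (B : C) : orthosys g -> 0 <= B ->
  (forall n, \sum_(0 <= i < n) `|c i| ^+ 2 <= B ^+ 2) ->
  exists2 x, series (fun n => c n *: g n) @ \oo --> x & `|x| <= B.
Proof.
move=> og B0 cB; have [b b0 Bb] := complex_ge0E B0.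
have : cvgn (series (fun n => sqn (c n))).
  apply: (@sum_bounded_cvg _ _ (b ^+ 2)) => [i|n]; first exact: sqn_ge0.
  by rewrite -lecR sum_sqnE rmorphXn /= -Bb.
move=> /cvg_cauchy /cauchy_seriesP sc.
have : cvgn (series (fun n => c n *: g n)).
  apply/cauchy_cvgP/cauchy_seriesP => e /complex_gt0E[r r0 ->].
  have := sc (r ^+ 2) (exprn_gt0 _ r0); apply: filterS => -[m n] /=.
  rewrite ger0_norm; last by apply: sumr_ge0 => i _; exact: sqn_ge0.
  rewrite -ltcR sum_sqnE rmorphXn /= => h.
  rewrite -(@ltr_pXn2r _ 2) ?nnegrE ?ler0c ?(ltW r0) //.
  by apply: le_lt_trans h; apply: normsq_orthosys_sum_le => //; exact: iota_uniq.
move=> cg; exists (limn (series (fun n => c n *: g n))) => //.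
apply: (@norm_lim_le _ \oo _ _ B _ B0 cg); near=> n.
rewrite -(@ler_pXn2r _ 2) ?nnegrE //; apply: le_trans (cB n).
by apply: normsq_orthosys_sum_le => //; exact: iota_uniq.
Unshelve. all: by end_near. Qed.

(** The Schmidt series with coefficients [a n], sending [f n] to [a n *: g n], converging pointwise
    on [H]. *)
Definition sysop a f g (T : H -> H) :=
  forall x, series (fun n => (a n * dot x (f n)) *: g n) @ \oo --> T x.

Lemma sum_sysop_coef_le a f (A : C) x n : orthosys f -> 0 <= A ->
  (forall n, `|a n| <= A) ->
  \sum_(0 <= i < n) `|a i * dot x (f i)| ^+ 2 <= (A * `|x|) ^+ 2.
Proof.
move=> of_ A0 aA; rewrite exprMn.
apply: (@le_trans _ _ (A ^+ 2 * \sum_(0 <= i < n) `|dot x (f i)| ^+ 2)).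
  rewrite mulr_sumr; apply: ler_sum => i _; rewrite normrM exprMn.
  by rewrite ler_wpM2r ?exprn_ge0 // ler_pXn2r // nnegrE.
by rewrite ler_wpM2l ?exprn_ge0 //; apply: bessel => //; exact: iota_uniq.
Qed.

Lemma sysop_norm_le a f g (A : C) (T : H -> H) : orthosys f -> orthosys g -> 0 <= A ->
  (forall n, `|a n| <= A) -> sysop a f g T -> forall x, `|T x| <= A * `|x|.
Proof.
move=> of_ og A0 aA sT x.
have [y cy yA] := orthosys_series_cvg og (mulr_ge0 A0 (normr_ge0 x))
  (fun n => sum_sysop_coef_le x n of_ A0 aA).
by rewrite (Hcvg_unique _ (sT x) cy).
Qed.

Lemma sysop_exists a f g (A : C) : orthosys f -> orthosys g -> 0 <= A ->
  (forall n, `|a n| <= A) -> exists T : {linear H -> H}, sysop a f g T.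
Proof.
move=> of_ og A0 aA.
have E x : exists y, series (fun n => (a n * dot x (f n)) *: g n) @ \oo --> y.
  by have [y] := orthosys_series_cvg og (mulr_ge0 A0 (normr_ge0 x))
    (fun n => sum_sysop_coef_le x n of_ A0 aA); exists y.
have [t tP] := choice E.
have tl : linear t.
  move=> k x y; apply: (Hcvg_unique _ (tP _)).
  have -> : series (fun n => (a n * dot (k *: x + y) (f n)) *: g n) =
      (fun n => k *: series (fun n => (a n * dot x (f n)) *: g n) n +
       series (fun n => (a n * dot y (f n)) *: g n) n).
    apply/funext => n; rewrite /series /= scaler_sumr -big_split /=.
    apply: eq_bigr => i _; rewrite dotDl dotZl scalerA -scalerDl; congr (_ *: _); ring.
  by apply: cvgD => //; exact: cvgZr.
pose lt := GRing.isLinear.Build _ _ _ _ t tl.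
pose T : {linear H -> H} := HB.pack t lt.
by exists T.
Qed.

(** Ideals are sets of bundled linear maps, so pointwise equality must be lifted to the bundles;
    their linearity proofs agree by proof irrelevance. *)
Lemma linear_ext X Y : X =1 Y -> X = Y.
Proof.
case: X Y => [X [[X1] [X2]]] [Y [[Y1] [Y2]]] /= /funext XY.
rewrite XY in X1 X2 *.
by rewrite (Prop_irrelevance X1 Y1) (Prop_irrelevance X2 Y2).
Qed.

Lemma bounded_linear_cont X (A : C) : 0 <= A -> (forall x, `|X x| <= A * `|x|) -> bounded_op X.
Proof.
move=> A0 XA x; apply/cvgrPdist_lt => e e0.
have A1 : 0 < A + 1 by rewrite ltr_wpDl.
have : \forall t \near x, `|x - t| < e / (A + 1).
  by apply: (@cvgr_dist_lt _ _ _ (nbhs x) _ id) => //; exact: divr_gt0.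
apply: filterS => t; rewrite ltr_pdivlMr // => xt; rewrite -linearB.
apply: le_lt_trans xt; apply: le_trans (XA _) _; rewrite mulrC ler_wpM2l //.
by rewrite lerDl.
Qed.

Lemma series_eventually_cst (V : normedModType C) (u : nat -> V) N (x : V) :
  (forall n, (N <= n)%N -> u n = 0) -> series u @ \oo --> x -> x = \sum_(0 <= i < N) u i.
Proof.
move=> u0 ux; apply: (@norm_cvg_unique _ _ (series u @ \oo)) => //.
apply: cvg_near_cst; near=> n.
have Nn : (N <= n)%N by near: n; exists N.
rewrite /series /= (big_cat_nat (n := N)) //= [X in _ + X]big_nat [X in _ + X]big1 ?addr0 //.
by move=> i /andP[/u0].
Unshelve. all: by end_near. Qed.

Lemma sysop_dot_out a f g (T : H -> H) x n : orthosys g -> sysop a f g T ->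
  dot (T x) (g n) = (g n != 0)%:R * (a n * dot x (f n)).
Proof.
move=> og sT; apply: (@cvg_eventually_cst _ _ n.+1 _ _ _ (cvg_dotl (y := g n) _ (sT x))).
move=> m nm; rewrite /series /= dot_orthosys_sum ?iota_uniq //.
by rewrite mem_index_iota /= nm.
Qed.

Lemma sysop_in a f g (T : H -> H) m : orthosys f -> sysop a f g T ->
  T (f m) = ((f m != 0)%:R * a m) *: g m.
Proof.
move=> of_ sT; rewrite (series_eventually_cst (N := m.+1) _ (sT _)) => [|n mn].
  rewrite big_nat_recr //= big_nat big1 ?add0r => [|i /andP[_ im]].
    by rewrite of_ eqxx /= mulrC.
  by rewrite orthosys_neq ?mulr0 ?scale0r // gtn_eqF.
by rewrite orthosys_neq ?mulr0 ?scale0r // ltn_eqF.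
Qed.

Lemma sysop_unique a f g X Y : sysop a f g X -> sysop a f g Y -> X = Y.
Proof. by move=> sX sY; apply: linear_ext => x; exact: (Hcvg_unique _ (sX x) (sY x)). Qed.

Lemma sysop_adjoint a f g X Y : sysop a f g X -> sysop (fun n => (a n)^*%R) g f Y ->
  is_adjoint dot X Y.
Proof.
move=> sX sY x y.
apply: (num_cvg_unique (F := \oo) (u := series (fun n => a n * dot x (f n) * dot (g n) y))).
  have -> : series (fun n => a n * dot x (f n) * dot (g n) y) =
    (fun n => dot (series (fun n => (a n * dot x (f n)) *: g n) n) y).
    by apply/funext => n; rewrite dot_suml; apply: eq_bigr => i _; rewrite dotZl.
  exact: cvg_dotl.
have -> : series (fun n => a n * dot x (f n) * dot (g n) y) =
  (fun n => dot x (series (fun n => ((a n)^*%R * dot y (g n)) *: f n) n)).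
  apply/funext => n; rewrite dot_sumr; apply: eq_bigr => i _.
  by rewrite dotZr rmorphM /= conjCK -dotC; ring.
exact: cvg_dotr.
Qed.

Lemma adjoint_unique X Y Y' : is_adjoint dot X Y -> is_adjoint dot X Y' -> Y = Y'.
Proof. by move=> a1 a2; apply: linear_ext => y; apply: dot_inj => z; rewrite -a1 a2. Qed.

(** * Multiplicities and uniqueness of singular numbers *)

(** If [k' < k], the coordinate matrix of [b] in terms of [b'] has a nonzero left kernel vector,
    which is a linear relation among the [b i]. *)
Lemma has_dim_le k k' (V : set H) : has_dim k V -> has_dim k' V -> (k <= k')%N.
Proof.
move=> [b [bi ->]] [b' [_ VV]]; rewrite leqNgt; apply/negP => kk.
have E i : exists c : 'I_k' -> C, b i = \sum_j c j *: b' j.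
  have : [set x | exists c : 'I_k -> C, x = \sum_i c i *: b i] (b i).
    exists (fun j => (j == i)%:R); rewrite (bigD1 i) //= eqxx scale1r big1 ?addr0 //.
    by move=> j /negbTE ->; rewrite scale0r.
  by rewrite VV.
have [c cE] := choice E.
pose M : 'M[C]_(k, k') := \matrix_(i, j) c i j.
have : kermx M != 0.
  rewrite -mxrank_eq0 mxrank_ker subn_eq0 -ltnNge.
  exact: leq_ltn_trans (rank_leq_col M) kk.
move=> /rowV0Pn[v /sub_kermxP vM v0]; case/negP: v0; apply/eqP/rowP => i.
rewrite mxE; apply: (bi (fun i => v 0 i)).
under eq_bigr do rewrite cE scaler_sumr.
rewrite exchange_big /= big1 // => j _.
under eq_bigr do rewrite scalerA.
rewrite -scaler_suml; move/rowP : vM => /(_ j); rewrite !mxE => vj.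
have -> : \sum_i0 v 0 i0 * c i0 j = 0; last by rewrite scale0r.
by rewrite -[RHS]vj; apply: eq_bigr => l _; rewrite mxE.
Qed.

Lemma has_dim_unique k k' (V : set H) : has_dim k V -> has_dim k' V -> k = k'.
Proof. by move=> h h'; apply/eqP; rewrite eqn_leq !(@has_dim_le _ _ V). Qed.

Lemma singular_numbers_unique X s s' :
  singular_numbers dot X s -> singular_numbers dot X s' -> s = s'.
Proof.
move=> [cs [Y aY sY]] [cs' [Y' aY' sY']]; rewrite (adjoint_unique aY' aY) in sY'.
apply: co_star_eq => // l l0; have [k [ck dk]] := sY l l0; have [k' [ck' dk']] := sY' l l0.
by apply: card_eq_trans ck _; rewrite (has_dim_unique dk dk') card_eq_sym.
Qed.

Lemma has_dim_orthosys f (r : seq nat) : orthosys f -> uniq r ->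
  (forall n, n \in r -> f n != 0) ->
  has_dim (size r) [set x | exists c : nat -> C, x = \sum_(n <- r) c n *: f n].
Proof.
move=> of_ ur fr; exists (fun i => f (nth 0%N r i)).
have E c : \sum_(n <- r) c n *: f n = \sum_(i < size r) c (nth 0%N r i) *: f (nth 0%N r i).
  by rewrite (big_nth 0%N) big_mkord.
split => [c c0 i|]; last first.
  apply/seteqP; split => [x [c ->]|x [c ->]]; first by exists (fun i => c (nth 0%N r i)).
  exists (fun n : nat => if (insub (index n r) : option 'I_(size r)) is Some i then c i else 0).
  rewrite E; apply: eq_bigr => i _; rewrite index_uniq //.
  by case: insubP => [j _ ji|/negP[]//]; congr (c _ *: _); apply: val_inj.
have := congr1 (dot^~ (f (nth 0%N r i))) c0; rewrite dot0l dot_suml (bigD1 i) //=.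
rewrite big1 ?addr0 => [|j ji]; last first.
  by rewrite dotZl orthosys_neq ?mulr0 // nth_uniq.
by rewrite dotZl orthosys_norm ?mulr1 // fr // mem_nth.
Qed.

(** The eigenspace of [Y \o X] for [l ^+ 2] is spanned by the finitely many [f n] with [s n = l],
    and these are orthonormal. *)
Lemma singular_numbers_sysop s f g X : co_star s -> orthosys f -> orthosys g ->
  (forall n, s n != 0 -> f n != 0 /\ g n != 0) ->
  sysop (fun n => (s n)%:C) f g X -> singular_numbers dot X s.
Proof.
move=> cs of_ og fg sX; split => //.
have s0 n : 0 <= s n by case: cs.
have sb n : `|(s n)%:C| <= (s 0%N)%:C.
  by rewrite ger0_norm ?ler0c // lecR; case: cs => _ + _; apply.
have sb0 : 0 <= (s 0%N)%:C by rewrite ler0c.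
have [Y sY] := sysop_exists og of_ sb0 sb.
exists Y.
  apply: sysop_adjoint sX _.
  by under eq_fun do rewrite (CrealP _) ?complex_real ?eqxx //.
move=> l l0.
have /cvgrPdist_lt/(_ _ l0)[N _ Nl] : s @ \oo --> 0 by case: cs.
have PN n : s n == l -> (n < N)%N.
  move=> /eqP sl; rewrite ltnNge; apply/negP => /Nl /=.
  by rewrite sub0r normrN sl gtr0_norm // ltxx.
have := finite_nat_enum PN; pose r := [seq n <- iota 0 N | s n == l]; rewrite -/r => cr.
exists (size r); split.
  by rewrite (_ : [set n | s n = l] = [set n | s n == l]) //; apply/seteqP; split=> n /eqP.
have ur : uniq r by rewrite filter_uniq // iota_uniq.
have fr n : n \in r -> f n != 0 /\ g n != 0.
  by rewrite mem_filter => /andP[/eqP sl _]; apply: fg; rewrite sl gt_eqF.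
have l20 : (l ^+ 2)%:C != 0 by rewrite eq_complex /= negb_and sqrf_eq0 gt_eqF.
have YXE x : series (fun n => ((s n)%:C * ((g n != 0)%:R * ((s n)%:C * dot x (f n)))) *: f n)
    @ \oo --> Y (X x).
  suff -> : (fun n => ((s n)%:C * ((g n != 0)%:R * ((s n)%:C * dot x (f n)))) *: f n) =
    (fun n => ((s n)%:C * dot (X x) (g n)) *: f n) by exact: sY.
  by apply/funext => n; rewrite (sysop_dot_out _ _ og sX).
rewrite (_ : [set x | _] = [set x | exists c : nat -> C, x = \sum_(n <- r) c n *: f n]).
  by apply: has_dim_orthosys => // n /fr[].
apply/seteqP; split => [x /= xl|x [c ->] /=]; last first.
  rewrite scaler_sumr [X (\sum_(_ <- _) _)]linear_sum linear_sum; apply: eq_big_seq => n nr.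
  have [fn gn] := fr n nr; move: nr; rewrite mem_filter => /andP[/eqP sl _].
  rewrite !linearZ /= (sysop_in _ of_ sX) linearZ (sysop_in _ og sY) fn gn !mul1r sl.
  by rewrite !scalerA; congr (_ *: _); rewrite rmorphXn /=; ring.
(* Pairing the eigenvalue equation with [f n] gives [s n ^+ 2 * dot x (f n) = l ^+ 2 * dot x (f
   n)]. *)
have dx n : s n != l -> dot x (f n) = 0.
  move=> sl; have [sn0|sn0] := eqVneq (s n) 0.
    have := sysop_dot_out (X x) n of_ sY; rewrite xl sn0 mul0r mulr0 dotZl.
    by move/eqP; rewrite mulf_eq0 (negbTE l20) => /eqP.
  have [fn gn] := fg n sn0.
  have := sysop_dot_out (X x) n of_ sY; rewrite xl (sysop_dot_out _ _ og sX) fn gn !mul1r dotZl.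
  rewrite mulrA => /eqP; rewrite -subr_eq0 -mulrBl mulf_eq0 => /orP[|/eqP//].
  rewrite -rmorphM -rmorphB /= eq_complex /= eqxx andbT subr_eq0 -expr2 eqrXn2 ?s0 ?(ltW l0) //.
  by rewrite eq_sym (negbTE sl).
exists (fun n => dot x (f n)).
have := series_eventually_cst (N := N) _ (YXE x).
rewrite xl => h; apply: (scalerI l20); rewrite h; last first.
  move=> n Nn; rewrite dx ?mulr0 ?scale0r //.
  by apply/negP => /PN; rewrite ltnNge Nn.
rewrite scaler_sumr big_filter [RHS]big_mkcond /index_iota subn0; apply: eq_bigr => n _.
case: ifP => [/eqP sl|sl]; last by rewrite dx ?sl // !mulr0 scale0r.
have [_ gn] : f n != 0 /\ g n != 0 by apply: fg; rewrite sl gt_eqF.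
by rewrite gn sl scalerA; congr (_ *: _); rewrite rmorphXn /=; ring.
Qed.

(** * Compactness of Schmidt series with null coefficients *)

Lemma nbhs_norm_lt (x : H) (e : C) : 0 < e -> nbhs x [set y | `|x - y| < e].
Proof. by move=> e0; have := nbhsx_ballx x e e0; rewrite -ball_normE. Qed.

(** [sup E] is the limit of [h] along [F]: the set where [h] is at least [sup E + d] is not in [F],
    so its complement is. *)
Lemma ultra_bounded_localize (I : Type) (F : set_system I) (h : I -> R) (b d : R) :
  UltraFilter F -> 0 < d -> F [set i | `|h i| <= b] ->
  exists c : R, F [set i | `|h i - c| < d].
Proof.
move=> FU d0 hb; pose E := [set t : R | F [set i | t <= h i]].
have ubE : ubound E b.
  move=> t tE; rewrite leNgt; apply/negP => bt.
  have [i [/= hi ti]] := filter_ex (filterI hb tE).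
  by have := le_trans (le_trans ti (ler_norm _)) hi; rewrite leNgt bt.
have hsE : has_sup E.
  split; last by exists b.
  exists (- b); apply: filterS hb => i /=; rewrite ler_norml => /andP[] //.
exists (sup E); have [t tE tsup] := sup_adherent d0 hsE.
have [h1|h1] := in_ultra_setVsetC [set i | sup E + d <= h i] FU.
  have := ub_le_sup (ex_intro _ b ubE) h1.
  by rewrite gerDl leNgt d0.
apply: filterS (filterI tE h1) => i /= [ti /negP]; rewrite -ltNge => hi.
by rewrite ltr_distl hi andbT (lt_le_trans tsup).
Qed.

Lemma normC_le_ReIm (z : C) : `|z| <= (`|complex.Re z| + `|complex.Im z|)%:C.
Proof.
have h0 : 0 <= (`|complex.Re z| + `|complex.Im z|)%:C by rewrite ler0c addr_ge0.
rewrite -(@ler_pXn2r _ 2) ?nnegrE // -sqnE -rmorphXn lecR /sqn.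
rewrite sqrrD !real_normK ?num_real // addrAC lerDl mulrn_wge0 // mulr_ge0.
Qed.

Lemma normC_ge_Im (z : C) : `|complex.Im z|%:C <= `|z|.
Proof.
have h0 : 0 <= `|complex.Im z|%:C by rewrite ler0c.
rewrite -(@ler_pXn2r _ 2) ?nnegrE // -sqnE -rmorphXn lecR /sqn.
by rewrite real_normK ?num_real // lerDr sqr_ge0.
Qed.

Lemma ultra_bounded_localizeC (I : Type) (F : set_system I) (h : I -> C) (b d : R) :
  UltraFilter F -> 0 < d -> F [set i | `|h i| <= b%:C] ->
  exists c : C, F [set i | `|h i - c| <= d%:C].
Proof.
move=> FU d0 hb; have d2 : 0 < d / 2 by rewrite divr_gt0.
have [c1 c1P] : exists c : R, F [set i | `|complex.Re (h i) - c| < d / 2].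
  apply: (ultra_bounded_localize (b := b)) => //; apply: filterS hb => i /= hi.
  by rewrite -lecR; apply: le_trans hi; exact: normc_ge_Re.
have [c2 c2P] : exists c : R, F [set i | `|complex.Im (h i) - c| < d / 2].
  apply: (ultra_bounded_localize (b := b)) => //; apply: filterS hb => i /= hi.
  by rewrite -lecR; apply: le_trans hi; exact: normC_ge_Im.
exists (c1 +i* c2); apply: filterS (filterI c1P c2P) => i /= [h1 h2].
apply: le_trans (normC_le_ReIm _) _; rewrite lecR [d]splitr.
move: h1 h2; case: (h i) => u v /= h1 h2; rewrite lerD // ltW //.
Qed.

Definition tail g N (y : H) := y - \sum_(0 <= n < N) dot y (g n) *: g n.

Lemma tailB g N y z : tail g N (y - z) = tail g N y - tail g N z.
Proof.
rewrite /tail; under eq_bigr do rewrite dotBl scalerBl.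
by rewrite sumrB !opprB addrACA [RHS]addrACA [- z + _]addrC.
Qed.

Lemma tail_norm_le g N y : orthosys g -> `|tail g N y| <= `|y|.
Proof.
move=> og; rewrite -(@ler_pXn2r _ 2) ?nnegrE //.
rewrite normsq_sub_projection ?iota_uniq // gerBl.
by apply: sumr_ge0 => n _; exact: exprn_ge0.
Qed.

Section CompactSysop.
Variables (s : nat -> R) (f g : nat -> H) (X : {linear H -> H}).
Hypotheses (cs : co_star s) (of_ : orthosys f) (og : orthosys g).
Hypothesis sX : sysop (fun n => (s n)%:C) f g X.

Let s0 n : 0 <= s n. Proof. by case: cs. Qed.

Lemma sysop_tail_le N x : `|x| <= 1 -> `|tail g N (X x)| <= (s N)%:C.
Proof.
move=> x1; pose c n := (s n)%:C * dot x (f n).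
have cl : (series (fun n => c n *: g n) n - \sum_(0 <= n < N) dot (X x) (g n) *: g n)
    @[n --> \oo] --> tail g N (X x).
  by apply: cvgB; [exact: sX|exact: cvg_cst].
apply: (@norm_lim_le _ \oo _ _ _ _ _ cl); first by rewrite ler0c.
near=> n; have Nn : (N <= n)%N by near: n; exists N.
have -> : series (fun n => c n *: g n) n - \sum_(0 <= n < N) dot (X x) (g n) *: g n =
    \sum_(N <= i < n) c i *: g i.
  rewrite /series /= (big_cat_nat (n := N)) //= addrAC -sumrB big1 ?add0r //.
  move=> i _; rewrite (sysop_dot_out _ _ og sX) -/(c i).
  by have [->|_] := eqVneq (g i) 0; rewrite ?scaler0 ?subrr // mul1r subrr.
rewrite -(@ler_pXn2r _ 2) ?nnegrE ?ler0c //.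
apply: le_trans (normsq_orthosys_sum_le og _ (iota_uniq _ _)) _.
apply: (@le_trans _ _ (\sum_(N <= i < n) (s N)%:C ^+ 2 * `|dot x (f i)| ^+ 2)).
  rewrite !big_seq; apply: ler_sum => i; rewrite mem_index_iota => /andP[Ni _].
  have sN0 : 0 <= (s N)%:C by rewrite ler0c.
  rewrite normrM exprMn ler_wpM2r ?exprn_ge0 // ler_pXn2r ?nnegrE //.
  by rewrite ger0_norm ?ler0c // lecR; case: cs => _ + _; apply.
rewrite -mulr_sumr ler_piMr ?exprn_ge0 ?ler0c //.
apply: le_trans (bessel of_ x (iota_uniq _ _)) _.
by rewrite exprn_ile1.
Unshelve. all: by end_near. Qed.

Lemma sysop_tail_closure N y : closure (X @` [set x | `|x| <= 1]) y ->
  `|tail g N y| <= (s N)%:C.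
Proof.
move=> cy; apply: norm_le_eps => [|e e0]; first by rewrite ler0c.
have [_ [[x x1 <-] /= xe]] := cy _ (nbhs_norm_lt y e0).
rewrite -(subrK (tail g N (X x)) (tail g N y)) -tailB addrC.
apply: le_trans (ler_normD _ _) _; apply: lerD; first exact: sysop_tail_le.
by apply: le_trans (tail_norm_le _ _ og) (ltW xe).
Qed.

(** Every ultrafilter on the closed image is Cauchy: the first [N] coefficients can be localized
    along it, and the remaining tail is uniformly at most [s N]. *)
Lemma sysop_compact : compact_op X.
Proof.
rewrite /compact_op; set A := closure _.
rewrite compact_ultra => F FU FA.
suff : cauchy F.
  move=> /cauchy_cvg Fl; exists (lim F); split; last exact: Fl.
  apply: closed_closure => B nB.
  by have [z [zA zB]] := @filter_ex _ F _ _ (@filterI _ F _ _ _ FA (Fl B nB)); exists z.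
apply: cauchy_exP => e /complex_gt0E [r r0 ->].
have r4 : 0 < r / 4 by rewrite divr_gt0.
have [_ _ /cvgrPdist_lt /(_ _ r4) [N _ /(_ N (leqnn N)) /=]] := cs.
rewrite sub0r normrN ger0_norm // => sN.
(* The [N] coordinates, each off by at most [2 d], cost at most [r / 4], and the two tails less than
   [r / 2]. Using [N.+1] keeps the quotient meaningful at [N = 0]. *)
pose d := r / (8 * N.+1%:R).
have d0 : 0 < d by rewrite divr_gt0 // mulr_gt0.
have dN : N%:R * (d + d) <= r / 4.
  have -> : N%:R * (d + d) = (N%:R / N.+1%:R) * (r / 4).
    by rewrite /d; field; rewrite nat1r pnatr_eq0.
  by rewrite ler_piMl ?(ltW r4) // ler_pdivrMr // mul1r ler_nat.
have loc n : exists c : C, F [set y | `|dot y (g n) - c| <= d%:C].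
  apply: (ultra_bounded_localizeC (b := s 0%N)) => //; apply: filterS FA => y /= yA.
  apply: le_trans (cauchy_schwarz _ _) _.
  have := sysop_tail_closure 0 yA; rewrite /tail big_geq // subr0 => yle.
  by apply: le_trans (ler_piMr (normr_ge0 _) (orthosys_le1 og n)) yle.
have [c cP] := choice loc.
have FB M : F [set y | forall n, (n < M)%N -> `|dot y (g n) - c n| <= d%:C].
  elim: M => [|M IH]; first by apply: filterS FA => y _ n.
  apply: filterS (filterI IH (cP M)) => y /= [h1 h2] n.
  by rewrite ltnS leq_eqVlt => /orP[/eqP ->|/h1].
have FAB : F (A `&` [set y | forall n, (n < N)%N -> `|dot y (g n) - c n| <= d%:C]).
  by apply: filterI => //; exact: FB.
have [y [yA yB]] := filter_ex FAB.
exists y; rewrite -ball_normE; apply: filterS FAB => z [zA zB] /=.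
have -> : y - z = (tail g N y - tail g N z) +
    \sum_(0 <= n < N) (dot y (g n) - dot z (g n)) *: g n.
  rewrite -tailB /tail -[LHS](subrK (\sum_(0 <= n < N) dot (y - z) (g n) *: g n)).
  by congr (_ + _); apply: eq_bigr => n _; rewrite dotBl.
apply: le_lt_trans (ler_normD _ _) _.
have B1 : `|tail g N y - tail g N z| <= (s N + s N)%:C.
  rewrite rmorphD /=; apply: le_trans (ler_normB _ _) _.
  by apply: lerD; exact: sysop_tail_closure.
have B2 : `|\sum_(0 <= n < N) (dot y (g n) - dot z (g n)) *: g n| <= (N%:R * (d + d))%:C.
  apply: le_trans (ler_norm_sum _ _ _) _.
  have -> : (N%:R * (d + d))%:C = \sum_(0 <= n < N) (d%:C + d%:C).
    by rewrite sumr_const_nat subn0 mulr_natl rmorphMn rmorphD.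
  rewrite !big_seq; apply: ler_sum => n; rewrite mem_index_iota => /andP[_ nN].
  rewrite normrZ; apply: le_trans (ler_piMr (normr_ge0 _) (orthosys_le1 og n)) _.
  rewrite -(subrK (c n) (dot y (g n))) -addrA.
  apply: le_trans (ler_normD _ _) _; apply: lerD; first exact: yB.
  by rewrite distrC; exact: zB.
apply: le_lt_trans (lerD B1 B2) _; rewrite -rmorphD /= ltcR.
by move: sN dN r0; lra.
Qed.

End CompactSysop.

(** * Singular value decomposition *)

Definition hnorm (x : H) : R := complex.Re `|x|.

Lemma hnormE x : `|x| = (hnorm x)%:C.
Proof. by rewrite RRe_real // realE normr_ge0. Qed.

Lemma hnorm_ge0 x : 0 <= hnorm x.
Proof. by rewrite -ler0c -hnormE. Qed.

Lemma hnorm0 : hnorm 0 = 0.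
Proof. by rewrite /hnorm normr0. Qed.

Lemma hnormD x y : hnorm (x + y) <= hnorm x + hnorm y.
Proof. by rewrite -lecR rmorphD /= -!hnormE ler_normD. Qed.

Lemma hnormN x : hnorm (- x) = hnorm x.
Proof. by rewrite /hnorm normrN. Qed.

Lemma hnormZ (k : R) x : hnorm (k%:C *: x) = `|k| * hnorm x.
Proof.
apply: complexI; rewrite rmorphM /= -!hnormE normrZ; congr (_ * _).
by rewrite normc_def /= expr0n addr0 sqrtr_sqr.
Qed.

Lemma hnorm_eq0 x : hnorm x = 0 -> x = 0.
Proof. by move=> h; apply/eqP; rewrite -normr_eq0 hnormE h. Qed.

Lemma hnorm_parallelogram x y :
  hnorm (x + y) ^+ 2 + hnorm (x - y) ^+ 2 = 2 * (hnorm x ^+ 2 + hnorm y ^+ 2).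
Proof.
apply: complexI; have := parallelogram x y; rewrite !hnormE -!rmorphXn -!rmorphD /= => ->.
by rewrite rmorphM /= rmorphMn.
Qed.

Lemma cvg_hnorm (u : nat -> H) x :
  (forall e : R, 0 < e -> \forall n \near \oo, hnorm (x - u n) < e) -> u @ \oo --> x.
Proof.
move=> h; apply/cvgrPdist_lt => e /complex_gt0E[r r0 ->].
by apply: filterS (h r r0) => n; rewrite hnormE ltcR.
Qed.

Lemma unit_ball_bound X (B : R) :
  (forall x, hnorm x <= 1 -> hnorm (X x) <= B) -> forall x, hnorm (X x) <= B * hnorm x.
Proof.
move=> XB x; have [x0|x0] := eqVneq (hnorm x) 0.
  by rewrite (hnorm_eq0 x0) linear0 hnorm0 mulr0.
have hx : 0 < hnorm x by rewrite lt_neqAle eq_sym x0 hnorm_ge0.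
have := XB ((hnorm x)^-1%:C *: x).
rewrite linearZ /= !hnormZ gtr0_norm ?invr_gt0 // mulVf // => /(_ (lexx _)).
by rewrite ler_pdivrMl // mulrC.
Qed.

Section Compact.
Variable X : {linear H -> H}.
Hypothesis cX : compact_op X.

Lemma compact_op_cluster (x : nat -> H) : (forall n, hnorm (x n) <= 1) ->
  exists y, forall (e : R) N, 0 < e -> exists2 n, (N <= n)%N & hnorm (y - X (x n)) < e.
Proof.
move=> x1; have FA : (X \o x @ \oo) (closure (X @` [set x | `|x| <= 1])).
  exists 0%N => // n _ /=; apply: subset_closure; exists (x n) => //=.
  by rewrite hnormE lecR.
have [y [_ cy]] := cX _ FA.
exists y => e N e0.
have e0C : 0 < e%:C by rewrite ltcR.
have FB : (X \o x @ \oo) [set z | exists2 n, (N <= n)%N & z = X (x n)].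
  by exists N => // n /= Nn; exists n.
have [_ [[n Nn ->] /= h]] := cy _ _ FB (nbhs_norm_lt y e0C).
by exists n => //; rewrite -ltcR -hnormE.
Qed.

(** Otherwise unit-ball vectors with images of norm above [n] exist for every [n], and such images
    have no cluster point. *)
Lemma compact_op_bounded : exists2 B : R, 0 <= B & forall x, hnorm (X x) <= B * hnorm x.
Proof.
apply: contrapT => h.
have H1 (n : nat) : exists x, hnorm x <= 1 /\ n%:R < hnorm (X x).
  apply: contrapT => hn; apply: h; exists n%:R => //; apply: unit_ball_bound => x x1.
  by rewrite leNgt; apply/negP => nx; apply: hn; exists x.
have [x xP] := choice H1.
have [y yP] := compact_op_cluster (fun n => (xP n).1).
have [n Nn yn] := yP 1 (Num.truncn (hnorm y + 1)).+1 ltr01.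
have := hnormD (- (y - X (x n))) y; rewrite hnormN opprB subrK.
have := (xP n).2; have := truncnS_gt (hnorm y + 1).
have : (Num.truncn (hnorm y + 1)).+1%:R <= n%:R :> R by rewrite ler_nat.
by lra.
Qed.

Lemma compact_op_continuous : continuous X.
Proof.
have [B B0 XB] := compact_op_bounded.
apply: (bounded_linear_cont (A := B%:C)) => [|x]; first by rewrite ler0c.
by rewrite !hnormE -rmorphM lecR.
Qed.

(** Compactness supplies a maximizing sequence in the complement of [r] whose images converge; the
    parallelogram law then makes the sequence itself Cauchy, so the supremum is attained. If [X]
    vanishes on the complement, [f = 0] is taken. *)
Lemma compact_op_maximizer (r : seq H) :
  exists f : H, [/\ forall y, y \in r -> dot f y = 0, f = 0 \/ hnorm f = 1
    & forall x, (forall y, y \in r -> dot x y = 0) -> hnorm (X x) <= hnorm (X f) * hnorm x].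
Proof.
pose V := [set x | forall y, y \in r -> dot x y = 0].
have VZ (k : R) x : V x -> V (k%:C *: x).
  by move=> Vx y yr; rewrite dotZl Vx // mulr0.
have VD x y : V x -> V y -> V (x + y).
  by move=> Vx Vy z zr; rewrite dotDl Vx // Vy // addr0.
have [B B0 XB] := compact_op_bounded.
pose E := [set t : R | exists x, [/\ V x, hnorm x <= 1 & t = hnorm (X x)]].
have hE : has_sup E.
  split; first by exists 0, 0; rewrite linear0 hnorm0 ler01; split=> // y _; rewrite dot0l.
  exists B => _ [x [_ x1 ->]]; apply: le_trans (XB x) _.
  by rewrite ler_piMr.
pose M := sup E.
have XM x : V x -> hnorm (X x) <= M * hnorm x.
  move=> Vx; have [x0|x0] := eqVneq (hnorm x) 0.
    by rewrite (hnorm_eq0 x0) linear0 hnorm0 mulr0.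
  have hx : 0 < hnorm x by rewrite lt_neqAle eq_sym x0 hnorm_ge0.
  have : E ((hnorm x)^-1 * hnorm (X x)).
    exists ((hnorm x)^-1%:C *: x); split; first exact: VZ.
      by rewrite hnormZ gtr0_norm ?invr_gt0 // mulVf.
    by rewrite linearZ /= hnormZ gtr0_norm ?invr_gt0.
  move=> /(ub_le_sup hE.2); rewrite ler_pdivrMl // mulrC; exact.
have M0 : 0 <= M.
  apply: (ub_le_sup hE.2); exists 0; rewrite linear0 hnorm0 ler01; split=> // y _.
  by rewrite dot0l.
have [M00|Mn0] := eqVneq M 0.
  exists 0; split; [by move=> y _; rewrite dot0l|by left|].
  by move=> x Vx; rewrite linear0 hnorm0; have := XM x Vx; rewrite M00.
have {M0 Mn0}Mp : 0 < M by rewrite lt_neqAle eq_sym Mn0 M0.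
pose d k : R := k.+1%:R^-1.
have d0 k : 0 < d k by rewrite invr_gt0.
have H1 n : exists x, [/\ V x, hnorm x <= 1 & M - d n < hnorm (X x)].
  by have [_ [x [Vx x1 ->]] h] := sup_adherent (d0 n) hE; exists x.
have [x xP] := choice H1.
have [y yP] := compact_op_cluster (fun n => let: And3 _ h _ := xP n in h).
have H2 k : exists z, [/\ V z, hnorm z <= 1, M - d k < hnorm (X z) & hnorm (y - X z) < d k].
  have [n kn yn] := yP (d k) k (d0 k); have [Vx x1 Mx] := xP n.
  exists (x n); split => //; apply: le_lt_trans Mx; rewrite lerD2l lerN2.
  by rewrite lef_pV2 ?posrE // ler_nat.
have {xP yP H1 x}[z zP] := choice H2.
have dcvg : d @ \oo --> 0 by exact: cvg_harmonic.
have My : M <= hnorm y.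
  apply/ler_addgt0Pr => e e0.
  have /cvgrPdist_lt /(_ _ (divr_gt0 e0 (ltr0n _ 2))) [N _ /(_ N (leqnn N)) /=] := dcvg.
  rewrite sub0r normrN gtr0_norm // => dN.
  have [_ _ h1 h2] := zP N.
  have := hnormD (- (y - X (z N))) y; rewrite hnormN opprB subrK; move: h1 h2 dN; lra.
(* [X (z k + z l)] is near [2 y], which forces [z k + z l] to have norm near 2; the parallelogram
   law leaves little room for the difference. *)
have zdist k l : hnorm (z k - z l) ^+ 2 * M <= 4 * (d k + d l).
  have [Vk k1 _ yk] := zP k; have [Vl l1 _ yl] := zP l.
  have h1 := XM _ (VD _ _ Vk Vl).
  have h2 : 2 * hnorm y <= hnorm (X (z k + z l)) + d k + d l.
    have -> : 2 * hnorm y = hnorm (2%:R%:C *: y) by rewrite hnormZ ger0_norm.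
    have -> : 2%:R%:C *: y = X (z k + z l) + ((y - X (z k)) + (y - X (z l))).
      rewrite linearD /= addrACA !subrKC rmorphMn scaler_nat mulr2n //.
    have := hnormD (X (z k + z l)) ((y - X (z k)) + (y - X (z l))).
    have := hnormD (y - X (z k)) (y - X (z l)); lra.
  have := hnorm_parallelogram (z k) (z l).
  have h3 : hnorm (z k + z l) <= 2 by apply: le_trans (hnormD _ _) _; lra.
  have h4 := hnorm_ge0 (z k + z l).
  have k0 := hnorm_ge0 (z k); have l0 := hnorm_ge0 (z l).
  have k2 : hnorm (z k) ^+ 2 <= 1 by rewrite expr_le1.
  have l2 : hnorm (z l) ^+ 2 <= 1 by rewrite expr_le1.
  have h5 : M * (2 - hnorm (z k + z l)) <= d k + d l by move: h1 h2 My; lra.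
  have h6 : M * (2 - hnorm (z k + z l)) * (2 + hnorm (z k + z l)) <= (d k + d l) * 4.
    apply: ler_pM => //; [|lra|lra].
    by apply: mulr_ge0; [exact: ltW|rewrite subr_ge0].
  move=> h7; have h8 : hnorm (z k - z l) ^+ 2 <= 4 - hnorm (z k + z l) ^+ 2 by move: h7; lra.
  have := ler_wpM2r (ltW Mp) h8; move: h6; lra.
have : cvgn z.
  apply/cauchy_cvgP; apply: cauchy_exP => e /complex_gt0E[t t0 ->].
  (* [zdist] carries a factor 4 and two terms [d N] and [d n], hence the 8. *)
  have e0 : 0 < t ^+ 2 * M / 8 by rewrite divr_gt0 // mulr_gt0 // exprn_gt0.
  have /cvgrPdist_lt /(_ _ e0) [N _ Nd] := dcvg.
  exists (z N); exists N => // n Nn; rewrite /= -ball_normE /= hnormE ltcR.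
  rewrite -(@ltr_pXn2r _ 2) ?nnegrE ?hnorm_ge0 ?(ltW t0) // -(ltr_pM2r Mp).
  have := Nd _ (leqnn N); have := Nd _ Nn; rewrite /= !sub0r !normrN !gtr0_norm //.
  have := zdist N n; lra.
move=> cz; set f := limn z in cz.
have Vf : V f.
  move=> w wr; apply: (@cvg_eventually_cst _ (fun n => dot (z n) w) 0).
    by move=> n _; have [Vz _ _ _] := zP n; exact: Vz.
  exact: cvg_dotl.
have f1 : hnorm f <= 1.
  rewrite -lecR -hnormE; apply: (@norm_lim_le _ \oo z _ 1 _ ler01 cz).
  by near=> n; rewrite hnormE lecR; case: (zP n).
have Xf : X f = y.
  apply: (@Hcvg_unique (X \o z @ \oo)).
    by apply: continuous_cvg cz; exact: compact_op_continuous.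
  apply: cvg_hnorm => e e0.
  have /cvgrPdist_lt /(_ _ e0) := dcvg; apply: filterS => n.
  rewrite sub0r normrN gtr0_norm //; have [_ _ _ h] := zP n; exact: lt_trans.
have fM : M <= hnorm (X f) by rewrite Xf.
exists f; split => //.
- right; apply/eqP; rewrite eq_le f1 /=.
  by have := le_trans fM (XM _ Vf); rewrite ler_pMr.
- move=> w Vw; apply: le_trans (XM _ Vw) _; rewrite ler_wpM2r ?hnorm_ge0 //.
Unshelve. all: by end_near. Qed.

End Compact.

Lemma real_complexD (u v : R) : (u + v)%:C = u%:C + v%:C. Proof. exact: rmorphD. Qed.
Lemma real_complexM (u v : R) : (u * v)%:C = u%:C * v%:C. Proof. exact: rmorphM. Qed.

Lemma hnorm_sqr x : (hnorm x ^+ 2)%:C = dot x x.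
Proof. by rewrite rmorphXn /= -hnormE hdot. Qed.

(* Expanding the squared inequality for k = t <X x, X y> with t small and positive,
   the first order term 2 t |<X x, X y>|^2 forces <X x, X y> = 0. *)
Lemma maximizer_image_orthogonal X x y : hnorm x = 1 -> hnorm y <= 1 -> dot x y = 0 ->
  (forall k : C, hnorm (X (x + k *: y)) <= hnorm (X x) * hnorm (x + k *: y)) ->
  dot (X x) (X y) = 0.
Proof.
move=> x1 y1 xy max; pose p := dot (X x) (X y); rewrite -/p.
pose S := hnorm (X x) ^+ 2; have S0 : 0 <= S by rewrite exprn_ge0 ?hnorm_ge0.
have S1 : 0 < S + 1 by rewrite ltr_wpDl.
(* Small enough that [t * S <= 1], so the second order term is at most half of the first order
   term. *)
pose t := (S + 1)^-1; have t0 : 0 < t by rewrite invr_gt0.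
pose k := t%:C * p.
have kk : k * k^*%R = (t ^+ 2 * sqn p)%:C.
  by rewrite -normCK /k normrM exprMn -sqnE -sqnE rmorphM /= /sqn /= expr0n addr0.
have kp : k^*%R * p + k * p^*%R = (2 * t * sqn p)%:C.
  have tt : (t%:C)^*%R = t%:C by apply/CrealP/complex_realP; exists t.
  rewrite /k rmorphM /= tt !rmorphM /= sqnE normCK rmorphMn /=; ring.
have E1 : hnorm (x + k *: y) ^+ 2 = 1 + t ^+ 2 * sqn p * hnorm y ^+ 2.
  apply: complexI; rewrite hnorm_sqr !dotDl !dotDr !dotZl !dotZr xy (dotC y x) xy rmorph0.
  rewrite real_complexD (real_complexM (_ * _)) -kk hnorm_sqr -(hnorm_sqr x) x1 expr1n; ring.
have E2 : hnorm (X (x + k *: y)) ^+ 2 =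
    S + 2 * t * sqn p + t ^+ 2 * sqn p * hnorm (X y) ^+ 2.
  apply: complexI; rewrite hnorm_sqr linearD linearZ /= !dotDl !dotDr !dotZl !dotZr.
  rewrite (dotC (X y) (X x)) -/p !real_complexD -kp (real_complexM (_ * _) (_ ^+ 2)) -kk /S.
  by rewrite !hnorm_sqr; ring.
have h1 : hnorm (X (x + k *: y)) ^+ 2 <= S * hnorm (x + k *: y) ^+ 2.
  by rewrite -exprMn ler_pXn2r ?nnegrE ?mulr_ge0 ?hnorm_ge0.
have q0 := sqn_ge0 p.
have tS : t * S <= 1 by rewrite mulrC ler_pdivrMr // mul1r lerDl.
have yy : hnorm y ^+ 2 <= 1 by rewrite expr_le1 ?hnorm_ge0.
have z0 : 0 <= t ^+ 2 * sqn p * hnorm (X y) ^+ 2.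
  by rewrite mulr_ge0 ?exprn_ge0 ?hnorm_ge0 // mulr_ge0 // exprn_ge0 // ltW.
have h2 : S * (t ^+ 2 * sqn p * hnorm y ^+ 2) <= t * sqn p.
  have -> : S * (t ^+ 2 * sqn p * hnorm y ^+ 2) = (t * S) * hnorm y ^+ 2 * (t * sqn p) by ring.
  apply: ler_piMl; first by rewrite mulr_ge0 // ltW.
  by rewrite mulr_ile1 ?exprn_ge0 ?hnorm_ge0 // mulr_ge0 // ltW.
rewrite E1 E2 (mulrDr S) (mulr1 S) in h1.
have h3 : t * sqn p <= 0 by move: h1 h2 z0; lra.
have : sqn p = 0.
  by apply/eqP; rewrite eq_le q0 andbT -(pmulr_rle0 _ t0).
move=> /(congr1 (fun r : R => r%:C)); rewrite sqnE => /eqP.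
by rewrite expf_eq0 /= normr_eq0 => /eqP.
Qed.

(** [f n] maximizes the norm of [X x] relative to that of [x] on the complement of its predecessors,
    and [s n] is the maximum. Maximality makes the images orthogonal, and compactness forces [s] to
    0. *)
Lemma svd X : compact_op X -> exists s f g, [/\ co_star s, orthosys f, orthosys g,
  forall n, s n != 0 -> f n != 0 /\ g n != 0 & sysop (fun n => (s n)%:C) f g X].
Proof.
move=> cX; have [f fP] := history_choice (compact_op_maximizer cX).
have inpre m n : (m < n)%N -> f m \in mkseq f n.
  by move=> mn; apply/mapP; exists m => //; rewrite mem_iota.
have f01 n : f n = 0 \/ hnorm (f n) = 1 by case: (fP n).
have f1 n : hnorm (f n) <= 1 by case: (f01 n) => ->; rewrite ?hnorm0 ?ler01.
have flt m n : (m < n)%N -> dot (f n) (f m) = 0.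
  by move=> mn; have [h _ _] := fP n; apply: h; exact: inpre.
have fne m n : m != n -> dot (f m) (f n) = 0.
  by rewrite neq_ltn => /orP[/flt|/flt] // h; rewrite dotC h rmorph0.
have of_ : orthosys f.
  move=> i j; have [->|/fne] := eqVneq i j; last exact.
  case: (f01 j) => h; first by rewrite h eqxx dot0l.
  rewrite -hnorm_sqr h expr1n; have [f0|//] := eqVneq (f j) 0.
  by move: h => /eqP; rewrite f0 hnorm0 eq_sym oner_eq0.
have Xmax n x : (forall m, (m < n)%N -> dot x (f m) = 0) ->
    hnorm (X x) <= hnorm (X (f n)) * hnorm x.
  move=> h; have [_ _ M] := fP n; apply: M => y /mapP[m]; rewrite mem_iota => /h mn ->.
  exact: mn.
pose s n := hnorm (X (f n)).
have s0 n : 0 <= s n by exact: hnorm_ge0.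
have sd : nonincreasing_seq s.
  move=> m n mn; apply: (@le_trans _ _ (s m * hnorm (f n))).
    by apply: Xmax => k km; apply: flt; exact: leq_trans km mn.
  by rewrite ler_piMr.
have Xo m n : m != n -> dot (X (f m)) (X (f n)) = 0.
  wlog mn : m n / (m < n)%N.
    move=> W; rewrite neq_ltn => /orP[mn|nm]; first by rewrite W // ltn_eqF.
    by rewrite dotC W ?rmorph0 // ltn_eqF.
  move=> _; case: (f01 m) => h.
    suff -> : X (f n) = 0 by rewrite dot0r.
    apply: hnorm_eq0; apply/eqP; rewrite eq_le hnorm_ge0 andbT.
    by apply: le_trans (sd m n (ltnW mn)) _; rewrite /s h linear0 hnorm0.
  apply: maximizer_image_orthogonal => // [|k]; first by rewrite fne // ltn_eqF.
  apply: Xmax => l lm; rewrite dotDl dotZl !flt ?mulr0 ?addr0 //; exact: ltn_trans lm mn.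
have cs : co_star s.
  split => //; suff small e : 0 < e -> exists N, s N < e.
    apply/cvgrPdist_lt => e e0; have [N sN] := small e e0; exists N => // n /= Nn.
    by rewrite sub0r normrN ger0_norm //; apply: le_lt_trans (sd _ _ Nn) sN.
  move=> e0; apply: contrapT => h.
  have es n : e <= s n by rewrite leNgt; apply/negP => se; apply: h; exists n.
  have [y yP] := compact_op_cluster cX f1.
  have e2 : 0 < e / 2 by rewrite divr_gt0.
  have [m _ ym] := yP (e / 2) 0%N e2; have [n mn yn] := yP (e / 2) m.+1 e2.
  (* Two images near the same cluster point are close, while Pythagoras puts orthogonal images of
     norm at least [e] farther apart. *)
  have h1 : hnorm (X (f m) - X (f n)) < e.
    have := hnormD (- (y - X (f m))) (y - X (f n)).
    by rewrite hnormN opprB addrA subrK; move: ym yn; lra.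
  have h2 : hnorm (X (f m) - X (f n)) ^+ 2 = s m ^+ 2 + s n ^+ 2.
    apply: complexI; rewrite /s real_complexD !hnorm_sqr dotBl !dotBr (dotC (X (f n)) (X (f m))).
    by rewrite (Xo m n) ?ltn_eqF // conjC0; ring.
  have h3 : hnorm (X (f m) - X (f n)) ^+ 2 < e ^+ 2.
    by rewrite ltr_pXn2r ?nnegrE ?hnorm_ge0 // ltW.
  have h4 : e ^+ 2 <= s m ^+ 2 by rewrite ler_pXn2r ?nnegrE ?(ltW e0).
  have := exprn_ge0 2 (s0 n); move: h2 h3 h4; lra.
(* Since the inverse of 0 is 0, [g n] is the zero vector when [s n = 0]. *)
pose g n := (s n)^-1%:C *: X (f n).
have sX n : (s n)%:C *: g n = X (f n).
  have [sn0|sn0] := eqVneq (s n) 0; last by rewrite scalerA -rmorphM /= divff // scale1r.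
  by rewrite sn0 scale0r (hnorm_eq0 sn0).
have og : orthosys g.
  move=> i j; have [<-|ij] := eqVneq i j; last by rewrite dotZl dotZr Xo // !mulr0.
  have [si0|si0] := eqVneq (s i) 0.
    by rewrite /g (hnorm_eq0 si0) scaler0 dot0l eqxx.
  have hg : hnorm (g i) = 1 by rewrite hnormZ ger0_norm ?invr_ge0 // mulVf.
  rewrite -hnorm_sqr hg expr1n; have [g0|//] := eqVneq (g i) 0.
  by move: hg => /eqP; rewrite g0 hnorm0 eq_sym oner_eq0.
exists s, f, g; split => // [n sn|x].
  split; apply: contraNneq sn => e; first by rewrite /s e linear0 hnorm0.
  by rewrite /s -sX e scaler0 hnorm0.
apply: cvg_hnorm => e e0.
have hx1 : 0 < hnorm x + 1 by rewrite ltr_wpDl ?hnorm_ge0.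
have [_ _ /cvgrPdist_lt /(_ _ (divr_gt0 e0 hx1))] := cs; apply: filterS => N.
rewrite sub0r normrN ger0_norm // ltr_pdivlMr // => sN.
(* The remainder is [X] applied to a vector orthogonal to [f 0, ..., f (N - 1)], so maximality
   bounds it by [s N] times the norm of [x]. *)
have -> : X x - series (fun n => ((s n)%:C * dot x (f n)) *: g n) N = X (tail f N x).
  rewrite /tail (linearB X) (linear_sum X) /series /=; congr (_ - _); apply: eq_bigr => i _.
  by rewrite [RHS]linearZ /= -(sX i) [RHS]scalerA [(s i)%:C * _]mulrC.
apply: le_lt_trans sN; apply: (@le_trans _ _ (s N * hnorm (tail f N x))).
  apply: Xmax => m mN; rewrite dotBl dot_orthosys_sum ?iota_uniq // mem_index_iota /= mN.
  have [->|_] := eqVneq (f m) 0; first by rewrite dot0r mul0r subrr.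
  by rewrite mul1r subrr.
rewrite ler_wpM2l //; apply: (@le_trans _ _ (hnorm x)); last by rewrite lerDl.
by rewrite -lecR -!hnormE; exact: tail_norm_le.
Qed.

Lemma compact_singular_numbers X : compact_op X -> exists s, singular_numbers dot X s.
Proof.
move=> /svd[s [f [g [cs of_ og fg sX]]]]; exists s; exact: singular_numbers_sysop sX.
Qed.

Lemma svd_singular X s : compact_op X -> singular_numbers dot X s ->
  exists f g, [/\ orthosys f, orthosys g,
  forall n, s n != 0 -> f n != 0 /\ g n != 0 & sysop (fun n => (s n)%:C) f g X].
Proof.
move=> /svd[s' [f [g [cs of_ og fg sX]]]] ss; exists f, g.
by rewrite (singular_numbers_unique ss (singular_numbers_sysop cs of_ og fg sX)).
Qed.

(* X = U Z V, where V and U carry one pair of singular bases to the other and U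
   rescales by xi / zeta (which is 0 where zeta vanishes, since then xi does). *)
Lemma ideal_singular_le (I : set {linear H -> H}) X Z xi zeta (M : R) : is_ideal I ->
  compact_op X -> singular_numbers dot X xi -> I Z -> singular_numbers dot Z zeta ->
  0 <= M -> (forall n, xi n <= M * zeta n) -> I X.
Proof.
move=> [_ Ic _ IL IR] cX sX IZ sZ M0 xz.
have xi0 n : 0 <= xi n by case: sX => -[].
have ze0 n : 0 <= zeta n by case: sZ => -[].
have [f [g [of_ og fg XE]]] := svd_singular cX sX.
have [f' [g' [of' og' fg' ZE]]] := svd_singular (Ic _ IZ) sZ.
pose a n := (xi n / zeta n)%:C.
have MC : 0 <= M%:C by rewrite ler0c.
have aM n : `|a n| <= M%:C.
  have q0 : 0 <= xi n / zeta n by rewrite divr_ge0.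
  rewrite ger0_norm ?ler0c // lecR; have [z0|z0] := eqVneq (zeta n) 0.
    by rewrite z0 invr0 mulr0.
  by rewrite ler_pdivrMr // lt_neqAle eq_sym z0 ze0.
have one_le (n : nat) : `|(fun=> 1 : C) n : C| <= 1 by rewrite normr1.
have [V VE] := sysop_exists (a := fun=> 1) of_ of' ler01 one_le.
have [U UE] := sysop_exists og' og MC aM.
have bU : bounded_op U.
  by apply: (bounded_linear_cont MC); exact: sysop_norm_le UE.
have bV : bounded_op V.
  by apply: (bounded_linear_cont ler01); exact: sysop_norm_le VE.
suff -> : X = (U \o (Z \o V : {linear H -> H}) : {linear H -> H}).
  by apply: IL => //; exact: IR.
apply: (sysop_unique XE) => x; rewrite /=.
suff -> : (fun n => ((xi n)%:C * dot x (f n)) *: g n) =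
  (fun n => (a n * dot (Z (V x)) (g' n)) *: g n) by exact: UE.
apply/funext => n; congr (_ *: _).
rewrite (sysop_dot_out _ _ og' ZE) (sysop_dot_out _ _ of' VE) mul1r.
have [z0|z0] := eqVneq (zeta n) 0.
  have -> : xi n = 0 by apply/eqP; rewrite eq_le xi0 andbT; have := xz n; rewrite z0 mulr0.
  by rewrite z0 !mul0r !mulr0.
have [-> ->] := fg' n z0; rewrite !mul1r mulrA -rmorphM /=.
by rewrite divfK.
Qed.

(** * Stochastic matrices of operators *)

Section Basis.
Variable e : nat -> H.
Hypothesis he : orthonormal_basis dot e.
Implicit Types (L : {linear H -> H}) (A : nat -> nat -> R) (Q : nat -> nat -> R).

Lemma basis_neq0 n : e n != 0.
Proof.
apply/eqP => en; have := he.1 n n; rewrite en dot0l eqxx => /eqP.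
by rewrite eq_sym oner_eq0.
Qed.

Lemma basis_orthosys : orthosys e.
Proof. by move=> i j; rewrite he.1 basis_neq0 andbT. Qed.

Lemma basis_norm n : `|e n| = 1.
Proof.
apply/eqP; rewrite -(@eqrXn2 _ 2) ?normr_ge0 // expr1n hdot he.1 eqxx.
exact: eqxx.
Qed.

Lemma basis_sysop : sysop (fun=> 1) e e id.
Proof. by move=> x; under eq_fun do rewrite mul1r; exact: he.2. Qed.

(** Every sequence of the cone is a singular number sequence; this is the way back from sequences to
    operators. *)
Lemma diagonal_op_exists s : co_star s ->
  exists2 D : {linear H -> H}, compact_op D & singular_numbers dot D s.
Proof.
move=> cs; have oe := basis_orthosys.
have s0 n : 0 <= s n by case: cs.
have sb n : `|(s n)%:C| <= (s 0%N)%:C.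
  by rewrite ger0_norm ?ler0c // lecR; case: cs => _ + _; apply.
have sb0 : 0 <= (s 0%N)%:C by rewrite ler0c.
have [D sD] := sysop_exists oe oe sb0 sb; exists D; first exact: sysop_compact sD.
by apply: singular_numbers_sysop sD => // n _; rewrite basis_neq0.
Qed.

Lemma parseval x : series (fun n => sqn (dot x (e n))) @ \oo --> hnorm x ^+ 2.
Proof.
have E N : series (fun n => sqn (dot x (e n))) N = hnorm x ^+ 2 - hnorm (tail e N x) ^+ 2.
  apply: complexI; rewrite real_complexD rmorphN /= !rmorphXn /= -!hnormE.
  rewrite normsq_sub_projection ?iota_uniq //; last exact: basis_orthosys.
  by rewrite opprB addrC subrK sum_sqnE.
rewrite (_ : series _ = (fun N => hnorm x ^+ 2 - hnorm (tail e N x) ^+ 2)); last exact/funext.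
rewrite -[X in _ --> X]subr0; apply: cvgB; first exact: cvg_cst.
have : hnorm (tail e N x) @[N --> \oo] --> 0.
  apply/cvgrPdist_lt => d d0; have dC : 0 < d%:C by rewrite ltcR.
  have /cvgrPdist_lt/(_ _ dC) := he.2 x; apply: filterS => N.
  by rewrite hnormE ltcR sub0r normrN ger0_norm ?hnorm_ge0.
by move=> h; rewrite -[X in _ --> X](mul0r 0); under eq_fun do rewrite expr2; exact: cvgM.
Qed.

Lemma stochastic_fromE (Lcls : set {linear H -> H}) Q : stochastic_from dot e Lcls Q ->
  exists L, [/\ Defs.contraction L, Lcls L & forall i j, Q i j = sqn (matrix_of dot e L i j)].
Proof.
move=> [L [cL LL QE]]; exists L; split => // i j; apply: complexI.
by rewrite QE sqnE.
Qed.

(** Columns: Bessel for [L (e j)]. Rows: with [x] the conjugated partial row and [S] its squared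
    norm, [dot (L x) (e i) = S], so contractivity gives [S ^+ 2 <= S]. *)
Lemma stochastic_from_substochastic (Lcls : set {linear H -> H}) Q :
  stochastic_from dot e Lcls Q -> substochastic Q.
Proof.
move=> /stochastic_fromE[L [cL _ QE]].
have Q0 i j : 0 <= Q i j by rewrite QE sqn_ge0.
split => [//|i|j]; apply: nneseries_le => // n; rewrite -lecR.
  under eq_bigr do rewrite QE; rewrite sum_sqnE; set S := \sum_(_ <= _ < _) _.
  have S0 : 0 <= S by apply: sumr_ge0 => j _; exact: exprn_ge0.
  pose x := \sum_(0 <= j < n) (matrix_of dot e L i j)^*%R *: e j.
  have xS : `|x| ^+ 2 = S.
    rewrite normsq_orthosys_sum ?iota_uniq //; last exact: basis_orthosys.
    by apply: eq_bigr => j _; rewrite basis_neq0 mul1r norm_conjC.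
  have LS : dot (L x) (e i) = S.
    rewrite linear_sum dot_suml; apply: eq_bigr => j _.
    by rewrite linearZ /= dotZl normCK mulrC.
  have := cauchy_schwarz (L x) (e i); rewrite LS basis_norm mulr1 ger0_norm // => h.
  have := le_trans h (cL x); rewrite -(@ler_pXn2r _ 2) ?nnegrE // xS.
  have [->|Sn0] := eqVneq S 0; first by rewrite ler01.
  have Sp : 0 < S by rewrite lt_neqAle eq_sym Sn0.
  by rewrite expr2 -{3}[S]mulr1 ler_pM2l.
under eq_bigr do rewrite QE; rewrite sum_sqnE.
apply: le_trans (bessel basis_orthosys (L (e j)) (iota_uniq _ _)) _.
by rewrite exprn_ile1 // -(basis_norm j) cL.
Qed.

Lemma stochastic_from_sub (K K' : set {linear H -> H}) : K `<=` K' ->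
  stochastic_from dot e K `<=` stochastic_from dot e K'.
Proof. by move=> KK Q [L [cL KL QE]]; exists L; split=> //; exact: KK. Qed.

(** By Parseval the column sums are the squared norms of [L (e j)], and the row sums those of the
    adjoint at [e i]. *)
Lemma orthostochastic_doubly Q : orthostochastic dot e Q -> doubly_stochastic Q.
Proof.
move=> oQ; have sQ := stochastic_from_substochastic oQ.
have [L [cL [[iL [L' aL iL']] _] QE]] := stochastic_fromE oQ.
have h1 j x : `|x| = `|e j| -> hnorm x ^+ 2 = 1.
  by rewrite basis_norm => x1; rewrite /hnorm x1 /= expr1n.
split; split => // i; apply: nneseries_cvg.
  rewrite -(h1 i (L' (e i))) ?iL' //.
  rewrite (_ : series _ = series (fun j => sqn (dot (L' (e i)) (e j)))); first exact: parseval.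
  apply: congr1; apply/funext => j; apply: complexI.
  by rewrite QE !sqnE /matrix_of aL dotC norm_conjC.
rewrite -(h1 i (L (e i))) ?iL //.
rewrite (_ : series _ = series (fun j => sqn (dot (L (e i)) (e j)))); first exact: parseval.
by apply: congr1; apply/funext => j; rewrite QE.
Qed.

Lemma fin_orthogonal_doubly_stochastic n (B : 'M[C]_n) :
  fin_orthogonal B -> fin_doubly_stochastic (map_mx sqn B).
Proof.
move=> [Br BB]; have BB' := mulmx1C BB.
have sB i j : (sqn (B i j))%:C = B i j * B i j.
  by rewrite sqnE real_normK ?Br // expr2.
split => [i j|i|j]; first by rewrite mxE sqn_ge0.
  apply: complexI; rewrite rmorph_sum; move/matrixP: BB => /(_ i i).
  rewrite !mxE eqxx => h; transitivity (true%:R : C) => //; rewrite -h.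
  by apply: eq_bigr => j _; rewrite !mxE; exact: sB.
apply: complexI; rewrite rmorph_sum; move/matrixP: BB' => /(_ j j).
rewrite !mxE eqxx => h; transitivity (true%:R : C) => //; rewrite -h.
by apply: eq_bigr => i _; rewrite !mxE; exact: sB.
Qed.

Lemma sqn0 : sqn 0 = 0.
Proof. by rewrite /sqn /= expr0n addr0. Qed.

Lemma block_orthostochastic_block_stochastic Q :
  block_orthostochastic dot e Q -> block_stochastic Q.
Proof.
move=> /stochastic_fromE[L [_ bL QE]].
rewrite (_ : Q = fun i j => sqn (matrix_of dot e L i j)); last first.
  by apply/funext => i; apply/funext => j; exact: QE.
exact: (direct_sum_of_map sqn0 fin_orthogonal_doubly_stochastic bL).
Qed.

Lemma dot_basis_inj x y : (forall i, dot x (e i) = dot y (e i)) -> x = y.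
Proof.
move=> xy; apply: (Hcvg_unique _ (he.2 x)).
by under eq_fun do rewrite xy; exact: he.2.
Qed.

Lemma bounded_sysop X : bounded_op X -> sysop (fun=> 1) e (X \o e) X.
Proof.
move=> cX x.
have -> : series (fun n => (1 * dot x (e n)) *: (X \o e) n) =
    (fun n => X (series (fun n => dot x (e n) *: e n) n)).
  apply/funext => n; rewrite /series /= (linear_sum X); apply: eq_bigr => i _.
  by rewrite [RHS]linearZ mul1r.
by apply: continuous_cvg (he.2 x); exact: cX.
Qed.

Definition orthonormal_seq g := forall i j, dot (g i) (g j) = (i == j)%:R.

Lemma orthonormal_seq_neq0 g n : orthonormal_seq g -> g n != 0.
Proof.
move=> og; apply/eqP => gn; have := og n n; rewrite gn dot0l eqxx => /eqP.
by rewrite eq_sym oner_eq0.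
Qed.

Lemma orthonormal_orthosys g : orthonormal_seq g -> orthosys g.
Proof. by move=> og i j; rewrite og orthonormal_seq_neq0 // andbT. Qed.

Let one_le (n : nat) : `|(fun=> 1 : C) n : C| <= 1. Proof. by rewrite normr1. Qed.

Lemma orthonormal_sysop_isometric g T : orthonormal_seq g ->
  sysop (fun=> 1) e g T -> isometric T.
Proof.
move=> ong sT x; have og := orthonormal_orthosys ong.
have TC x' n : dot (T x') (g n) = dot x' (e n).
  by rewrite (sysop_dot_out _ _ og sT) orthonormal_seq_neq0 // !mul1r.
apply/eqP; rewrite -(@eqrXn2 _ 2) ?normr_ge0 // !hdot; apply/eqP.
apply: (num_cvg_unique (F := \oo) _ (cvg_dotr (y := T x) _ (sT x))).
under eq_fun do rewrite dot_sumr.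
have h : dot x (series (fun n => (1 * dot x (e n)) *: e n) n) @[n --> \oo] --> dot x x.
  by apply: cvg_dotr; exact: basis_sysop.
rewrite (_ : (fun n => \sum_(_ <= _ < _) _) =
  (fun n => dot x (series (fun n => (1 * dot x (e n)) *: e n) n))) //.
apply/funext => n; rewrite dot_sumr; apply: eq_bigr => i _.
by rewrite !dotZr TC.
Qed.

Lemma fin_orthogonal_tr n (B : 'M[C]_n) : fin_orthogonal B -> fin_orthogonal B^T.
Proof.
by move=> [Br BB]; split=> [i j|]; rewrite ?mxE // trmxK; exact: mulmx1C.
Qed.

(** Rows are finite combinations of basis vectors, and for real entries [B *m B^T = 1] is
    orthonormality for the Hermitian form. *)
Lemma direct_sum_orthonormal_rows (A : nat -> nat -> C) : direct_sum_of fin_orthogonal A ->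
  exists2 h : nat -> H, orthonormal_seq h & forall i j, dot (h i) (e j) = A i j.
Proof.
move=> dA.
have Ar i j : A i j \is Num.real.
  by apply: (direct_sum_of_entry (p := fun z => z \is Num.real) _ _ dA) => // n B [].
have [N NP] := choice (fun i => direct_sum_of_support i dA).
pose h i := \sum_(0 <= j < N i) A i j *: e j.
have hE i n : (N i <= n)%N -> h i = \sum_(0 <= j < n) A i j *: e j.
  move=> Nn; rewrite (big_cat_nat (n := N i)) //= [X in _ + X]big_nat.
  by rewrite [X in _ + X]big1 ?addr0 // => j /andP[/NP -> _]; rewrite scale0r.
have hA i j : dot (h i) (e j) = A i j.
  rewrite (hE i (N i + j.+1)%N) ?leq_addr // dot_orthosys_sum ?iota_uniq //.
    by rewrite mem_index_iota basis_neq0 andbT /= ltn_addl // mul1r.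
  exact: basis_orthosys.
exists h => // i i'.
have [M MP] := direct_sum_row_gram
  (direct_sum_of_imply (fun n B (h : fin_orthogonal B) => h.2) dA) i i'.
rewrite -(MP (maxn (N i') M)) ?leq_maxr // (hE i' (maxn (N i') M)) ?leq_maxl //.
rewrite dot_sumr; apply: eq_bigr => j _.
by rewrite dotZr hA mulrC; congr (_ * _); apply/CrealP.
Qed.

(** By continuity [L] is determined by its orthonormal columns, hence isometric. Its adjoint sends
    the basis to the orthonormal rows and is isometric for the same reason. *)
Lemma block_orthogonal_orthogonal L : bounded_op L -> block_orthogonal dot e L ->
  orthogonal_op dot e L.
Proof.
move=> cL bL.
have [h oh hE] := direct_sum_orthonormal_rows bL.
have bT : direct_sum_of fin_orthogonal (fun i j => matrix_of dot e L j i).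
  by apply: direct_sum_of_imply (direct_sum_of_tr bL) => n B /fin_orthogonal_tr; rewrite trmxK.
have [g ong gE] := direct_sum_orthonormal_rows bT.
have og := orthonormal_orthosys ong.
have Lr i j : matrix_of dot e L i j \is Num.real.
  by apply: (direct_sum_of_entry (p := fun z => z \is Num.real) _ _ bL) => // n B [].
have sL : sysop (fun=> 1) e g L.
  suff <- : L \o e = g by exact: bounded_sysop.
  by apply/funext => j; apply: dot_basis_inj => i; rewrite gE.
have [L' sL'] := sysop_exists og basis_orthosys ler01 one_le.
have cL' : bounded_op L'.
  apply: (bounded_linear_cont ler01); exact: (sysop_norm_le og basis_orthosys ler01 one_le sL').
split=> //; split; first exact: orthonormal_sysop_isometric sL.
exists L'; first by apply: sysop_adjoint sL _; under eq_fun do rewrite conjC1.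
apply: (orthonormal_sysop_isometric oh).
suff <- : L' \o e = h by exact: bounded_sysop.
apply/funext => i; apply: dot_basis_inj => j; rewrite hE /=.
rewrite (sysop_dot_out _ _ basis_orthosys sL') basis_neq0 !mul1r dotC gE.
exact/CrealP.
Qed.

Lemma contraction_bounded L : Defs.contraction L -> bounded_op L.
Proof. by move=> cL; apply: (bounded_linear_cont ler01) => x; rewrite mul1r. Qed.

Lemma block_orthostochastic_orthostochastic Q :
  block_orthostochastic dot e Q -> orthostochastic dot e Q.
Proof.
move=> [L [cL bL QE]]; exists L; split=> //.
by apply: block_orthogonal_orthogonal => //; exact: contraction_bounded.
Qed.

Lemma direct_sum_block_orthostochastic A :
  direct_sum_of (fun n (B : 'M[R]_n) => B *m B^T = 1%:M) A ->
  block_orthostochastic dot e (fun i j => A i j ^+ 2).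
Proof.
move=> dA; pose AC i j := (A i j)%:C.
have dAC : direct_sum_of fin_orthogonal AC.
  apply: (direct_sum_of_map (f := real_complex R)) dA => // n B BB; split => [i j|].
    by rewrite mxE; apply/complex_realP; exists (B i j).
  by rewrite map_trmx -map_mxM BB map_mx1.
have bT : direct_sum_of fin_orthogonal (fun i j => AC j i).
  by apply: direct_sum_of_imply (direct_sum_of_tr dAC) => n B /fin_orthogonal_tr; rewrite trmxK.
have [g ong gE] := direct_sum_orthonormal_rows bT.
have og := orthonormal_orthosys ong.
have [L sL] := sysop_exists basis_orthosys og ler01 one_le.
have LA : matrix_of dot e L = AC.
  apply/funext => i; apply/funext => j.
  by rewrite /matrix_of (sysop_in _ basis_orthosys sL) basis_neq0 mul1r scale1r gE.
exists L; split => [x||i j].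
- by have := sysop_norm_le basis_orthosys og ler01 one_le sL x; rewrite mul1r.
- by rewrite /block_orthogonal LA.
- by rewrite LA /AC -sqnE /sqn /= expr0n addr0.
Qed.

(* L is the Householder reflection exchanging e_0 and the unit vector with
   coordinates u. *)
Lemma orthogonal_op_first_column (u : nat -> R) :
  series (fun n => u n ^+ 2) @ \oo --> (1 : R) ->
  exists L, [/\ Defs.contraction L, orthogonal_op dot e L
    & forall i, matrix_of dot e L i 0%N = (u i)%:C].
Proof.
move=> u1; have oe := basis_orthosys.
have uB n : \sum_(0 <= i < n) `|(u i)%:C| ^+ 2 <= 1 ^+ 2.
  rewrite expr1n -sum_sqnE -[1]/(1%:C) lecR.
  rewrite (eq_bigr (fun i => u i ^+ 2)); last by move=> i _; rewrite /sqn /= expr0n addr0.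
  apply: (@le_trans _ _ (limn (series (fun n => u n ^+ 2)))).
    apply: nondecreasing_cvgn_le; last by apply/cvg_ex; exists 1.
    by apply/nondecreasing_seqP => k; rewrite /series /= big_nat_recr //= lerDl sqr_ge0.
  by rewrite (cvg_lim _ u1).
have [U cU _] := orthosys_series_cvg (c := fun i => (u i)%:C) oe ler01 uB.
have Ue n : dot U (e n) = (u n)%:C.
  apply: (@cvg_eventually_cst _ _ n.+1 _ _ _ (cvg_dotl (y := e n) _ cU)).
  move=> m nm; rewrite /series /= dot_orthosys_sum ?iota_uniq //.
  by rewrite mem_index_iota /= nm basis_neq0 mul1r.
have U1 : dot U U = 1.
  rewrite -hnorm_sqr; apply: congr1 (_ : _ = 1).
  rewrite -(cvg_lim (@Rhausdorff R) (@parseval U)) -(cvg_lim (@Rhausdorff R) u1).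
  congr (limn (series _)).
  by apply/funext => n; rewrite Ue /sqn /= expr0n addr0.
pose v := e 0%N - U.
have U0r : dot (e 0%N) U = (u 0%N)%:C.
  by rewrite dotC Ue; apply/CrealP/complex_realP; exists (u 0%N).
have ve n : dot v (e n) = ((0%N == n)%:R - u n)%:C.
  by rewrite dotBl he.1 Ue rmorphB /= rmorph_nat.
have ev n : dot (e n) v = dot v (e n).
  by rewrite dotC; apply/CrealP; rewrite ve; apply/complex_realP; eexists.
(* Both vectors are unit and their inner product is real; this identity makes the reflection along
   [v] send [e 0] to [U]. *)
have vv : dot v v = 2 * dot v (e 0%N).
  rewrite /v !dotBl !dotBr U1 !he.1 !Ue U0r eqxx /=; ring.
(* When [U = e 0] this is [2 / 0 = 0], and the reflection degenerates to the identity. *)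
pose k : C := 2 / dot v v.
have kr : k^*%R = k.
  by apply/CrealP; rewrite ger0_real // divr_ge0 // -hdot exprn_ge0.
have kv : k * dot v v * k = 2 * k.
  have [v0|v0] := eqVneq (dot v v) 0; first by rewrite /k v0 invr0; ring.
  by rewrite /k; field.
have kve : dot v v != 0 -> k * dot v (e 0%N) = 1.
  move=> v0; have vn : dot v (e 0%N) != 0 by apply: contraNneq v0 => h; rewrite vv h mulr0.
  by rewrite /k vv; field.
clearbody k v; pose l x := x - (k * dot x v) *: v.
have ll : linear l.
  move=> c x y; rewrite /l dotDl dotZl mulrDr scalerDl scalerBr scalerA.
  by rewrite opprD addrACA [k * (c * _)]mulrCA.
pose lb := GRing.isLinear.Build _ _ _ _ l ll.
pose L : {linear H -> H} := HB.pack l lb.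
have LE x : L x = x - (k * dot x v) *: v by [].
have La : is_adjoint dot L L.
  move=> x y; rewrite !LE dotBl dotBr dotZl dotZr rmorphM /= kr -(dotC v y); ring.
have Li : isometric L.
  move=> x; apply/eqP; rewrite -(@eqrXn2 _ 2) ?normr_ge0 // !hdot La; apply/eqP.
  congr (dot _ _); rewrite !LE dotBl dotZl -addrA -opprD -scalerDl.
  rewrite (_ : _ + _ = 2 * (k * dot x v) - (k * dot v v * k) * dot x v); last by ring.
  by rewrite kv mulrA subrr scale0r subr0.
have Lm i j : matrix_of dot e L i j = (j == i)%:R - k * dot v (e j) * dot v (e i).
  by rewrite /matrix_of LE dotBl dotZl he.1 ev.
exists L; split; first by move=> x; rewrite Li.
- split; first by split=> //; exists L.
  move=> i j; apply/CrealP; rewrite Lm rmorphB /= rmorph_nat !rmorphM /= kr.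
  by rewrite -!dotC !ev.
- move=> i; rewrite Lm.
  have [v0|v0] := eqVneq (dot v v) 0; last first.
    by rewrite kve // mul1r ve rmorphB /= rmorph_nat opprB addrC subrK.
  have v00 : v = 0 by apply/eqP; rewrite -normr_eq0 -sqrf_eq0 hdot v0.
  have := ve i; rewrite v00 dot0l mulr0 subr0 => /eqP.
  by rewrite rmorphB /= rmorph_nat eq_sym subr_eq0 => /eqP.
Qed.

Lemma char_set_co_star (I : set {linear H -> H}) s : char_set dot I s -> co_star s.
Proof. by move=> [X _ []]. Qed.

Lemma invariant_under_sub (K K' : set (nat -> nat -> R)) (I : set {linear H -> H}) :
  K `<=` K' -> invariant_under dot K' I -> invariant_under dot K I.
Proof. by move=> KK inv P xi /KK; exact: inv. Qed.

(** * Invariant ideals and am-closure *)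

Section Ideal.
Variable I : set {linear H -> H}.
Hypothesis hI : is_ideal I.

Lemma ideal_compact X : I X -> compact_op X.
Proof. by case: hI => _ h _ _ _; exact: h. Qed.

Lemma am_closed_substochastic :
  am_closed dot I -> invariant_under dot substochastic I.
Proof.
move=> amI P xi sP xiI; have cx := char_set_co_star xiI.
have [zeta [rz mz]] := substochastic_rearrangement sP cx.
exists zeta => //; have cz : co_star zeta by case: rz.
(* Membership in [am_closure] is a statement about operators: [D] carries [zeta], and [D'] carries
   its mean as a member of [am I]. *)
have [D cD sD] := diagonal_op_exists cz.
have [D' cD' sD'] := diagonal_op_exists (co_star_arithmetic_mean cz).
exists D => //; rewrite amI; split => //; exists zeta => //; split => //.
exists D' => //; split => //; exists (arithmetic_mean zeta) => //; split.
  exact: co_star_arithmetic_mean.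
exists xi => //; exists 1 => //; apply/arithmetic_mean_le => n; rewrite mul1r; exact: mz.
Qed.

Lemma ideal_nonzero_singular : exists2 s, char_set dot I s & 0 < s 0%N.
Proof.
have [[X IX [x Xx]] _ _ _ _] := hI.
have [s [f [g [cs of_ og fg sX]]]] := svd (ideal_compact IX).
exists s; first by exists X => //; exact: singular_numbers_sysop sX.
have [s0 sd _] := cs; rewrite lt_neqAle s0 andbT; apply: contraNneq Xx => s00.
have sn n : s n = 0 by apply/eqP; rewrite eq_le s0 andbT s00 sd.
have h := @series_eventually_cst _ _ 0%N _ _ (sX x).
by rewrite h ?big_geq // => n _; rewrite sn mul0r scale0r.
Qed.

(** With first column [t / S], the matrix [Q] spreads the single positive number [s 0] over all
    rows: [Q s] is at least [(s 0 / S) t]. *)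
Lemma orthostochastic_trace_class :
  invariant_under dot (orthostochastic dot e) I -> trace_class dot `<=` I.
Proof.
move=> inv X [cX [t sX [ct tS]]]; have [t0 td _] := ct.
have [s sI sp] := ideal_nonzero_singular; have cs := char_set_co_star sI.
have ct1 : cvgn (series t).
  apply: (@sum_bounded_cvg _ _ (fine (\sum_(0 <= i <oo) (t i)%:E)%E)) => // n.
  apply: sum_le_nneseries => //; rewrite fineK // ge0_fin_numE //.
  by apply: nneseries_ge0 => i _ _; rewrite lee_fin.
pose S := limn (series t).
have tn n : t n <= S.
  apply: (@le_trans _ _ (series t n.+1)).
    by rewrite /series /= big_nat_recr //= lerDr sumr_ge0.
  apply: nondecreasing_cvgn_le => //; apply/nondecreasing_seqP => k.
  by rewrite /series /= big_nat_recr //= lerDl.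
have [Z IZ sZ] := sI.
have [S0|S0] := eqVneq S 0.
  apply: (ideal_singular_le hI cX sX IZ sZ (lexx 0)) => n.
  by rewrite mul0r -S0.
have Sp : 0 < S by rewrite lt_neqAle eq_sym S0 (le_trans (t0 0%N)).
pose u n := Num.sqrt (t n / S).
have u2 n : u n ^+ 2 = t n / S by rewrite sqr_sqrtr // divr_ge0 // ltW.
have u1 : series (fun n => u n ^+ 2) @ \oo --> (1 : R).
  rewrite (_ : series _ = (fun n => series t n * S^-1)); last first.
    by apply/funext => n; rewrite /series /= mulr_suml; apply: eq_bigr => i _; exact: u2.
  by rewrite -[X in _ --> X](divff S0); apply: cvgM => //; exact: cvg_cst.
have [L [cL oL L0]] := orthogonal_op_first_column u1.
pose Q i j := sqn (matrix_of dot e L i j).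
have oQ : orthostochastic dot e Q by exists L; split => // i j; exact: sqnE.
have sQ := stochastic_from_substochastic oQ.
have [zeta rz [W IW sW]] := inv Q s oQ sI.
have dn : nonincreasing_seq (fun n => s 0%N / S * t n).
  by move=> m n mn; apply: ler_wpM2l; [rewrite divr_ge0 // ltW|exact: td].
have le n : s 0%N / S * t n <= apply_matrix Q s n.
  apply: le_trans (apply_matrix_ge sQ cs 1 n).
  rewrite big_nat1 /Q L0 /sqn /= expr0n addr0 u2.
  suff -> : s 0%N / S * t n = t n / S * s 0%N by []; ring.
have h := le_rearrangement (apply_matrix_ge0 sQ cs) (apply_matrix_cvg0 sQ cs) rz dn le.
have q0 : 0 <= S / s 0%N by rewrite divr_ge0 // ltW.
apply: (ideal_singular_le hI cX sX IW sW q0) => n.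
have := ler_wpM2l q0 (h n); apply: le_trans.
suff -> : S / s 0%N * (s 0%N / S * t n) = t n by [].
by field; rewrite S0 gt_eqF.
Qed.

Lemma sub_am_closure : I `<=` am_closure dot I.
Proof.
move=> X IX; have cX := ideal_compact IX; have [s sX] := compact_singular_numbers cX.
have cs : co_star s by case: sX.
have [D cD sD] := diagonal_op_exists (co_star_arithmetic_mean cs).
split => //; exists s => //; split => //; exists D => //; split => //.
exists (arithmetic_mean s) => //; split; first exact: co_star_arithmetic_mean.
by exists s; [exists X|exists 1 => // n; rewrite mul1r].
Qed.

Lemma block_orthostochastic_am_closed : trace_class dot `<=` I ->
  invariant_under dot (block_orthostochastic dot e) I -> am_closed dot I.
Proof.
move=> L1I inv; apply/seteqP; split; first exact: sub_am_closure.
move=> X [cX [xi sX [cxi [Z [cZ [zeta sZ [_ [eta etaI [M M0 zM]]]]] sZ']]]].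
(* [Z] comes with two singular sequences, one bounded by a multiple of the mean of [eta], the other
   the mean of [xi]. *)
rewrite (singular_numbers_unique sZ sZ') in zM.
have {zM} /arithmetic_mean_le xe := zM.
have xi0 n : 0 <= xi n by case: cxi.
have [xis|xins] := pselect (cvgn (series xi)).
  apply: L1I; split => //; exists xi => //; split => //.
  by rewrite (nneseries_cvg xis) ltry.
have ce := char_set_co_star etaI.
have [A [dA AP]] := nonsummable_block_majorization cxi ce M0 xins xe.
have bQ := direct_sum_block_orthostochastic dA.
have sQ := stochastic_from_substochastic bQ.
have [z rz [W IW sW]] := inv _ _ bQ etaI.
have M2 : 0 < 2 * M by rewrite mulr_gt0.
have dn : nonincreasing_seq (fun n => (2 * M)^-1 * xi n).
  move=> m n mn; apply: ler_wpM2l; first by rewrite invr_ge0 ltW.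
  by case: cxi => _ + _; apply.
have le n : (2 * M)^-1 * xi n <= apply_matrix (fun i j => A i j ^+ 2) eta n.
  have [N NP] := AP n; rewrite ler_pdivrMl //; apply: le_trans (NP N (leqnn N)) _.
  by rewrite ler_wpM2l ?(ltW M2) //; exact: apply_matrix_ge.
have h := le_rearrangement (apply_matrix_ge0 sQ ce) (apply_matrix_cvg0 sQ ce) rz dn le.
apply: (ideal_singular_le hI cX sX IW sW (ltW M2)) => n.
by have := h n; rewrite ler_pdivrMl.
Qed.

Lemma orthostochastic_am_closed :
  invariant_under dot (orthostochastic dot e) I -> am_closed dot I.
Proof.
move=> inv; apply: block_orthostochastic_am_closed.
  exact: orthostochastic_trace_class.
exact: invariant_under_sub block_orthostochastic_orthostochastic inv.
Qed.

End Ideal.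
End Basis.
End Hilbert.

Theorem corollary8p7 (R : realType) (H : completeNormedModType (complex R))
    (dot : {dot H for conjC}) (e : nat -> H)
    (hdot : hilbert_inner_product dot) (he : orthonormal_basis dot e)
    (I : set {linear H -> H}) (hI : is_ideal I) :
  [<-> am_closed dot I ;
       invariant_under dot substochastic I ;
       invariant_under dot row_stochastic I ;
       invariant_under dot column_stochastic I ;
       invariant_under dot doubly_stochastic I ;
       invariant_under dot (isometry_stochastic dot e) I ;
       invariant_under dot (coisometry_stochastic dot e) I ;
       invariant_under dot (unistochastic dot e) I ;
       invariant_under dot (orthostochastic dot e) I ;
       trace_class dot `<=` I /\ invariant_under dot block_stochastic I ;
       trace_class dot `<=` I /\
         invariant_under dot (block_orthostochastic dot e) I ].
Proof.
have am_sub := am_closed_substochastic hdot he.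
(* Invariance under any class containing the orthostochastic matrices thus gives invariance under
   all substochastic ones; this closes each step of the cycle that leaves a class for one not
   contained in it. *)
have ortho_sub K : orthostochastic dot e `<=` K -> invariant_under dot K I ->
    invariant_under dot substochastic I.
  move=> oK inv; apply: am_sub; apply: (orthostochastic_am_closed hdot he hI).
  exact: invariant_under_sub oK inv.
have row_sub : @row_stochastic R `<=` substochastic by move=> P [].
have col_sub : @column_stochastic R `<=` substochastic by move=> P [].
have dbl_row : @doubly_stochastic R `<=` row_stochastic by move=> P [].
have dbl_col : @doubly_stochastic R `<=` column_stochastic by move=> P [].
have ortho_dbl := @orthostochastic_doubly _ _ _ hdot _ he.
have from_sub (K : set {linear H -> H}) : stochastic_from dot e K `<=` substochastic.
  by move=> P; exact: (stochastic_from_substochastic hdot he).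
have ortho_uni : orthostochastic dot e `<=` unistochastic dot e.
  by apply: stochastic_from_sub => L [].
have uni_iso : unistochastic dot e `<=` isometry_stochastic dot e.
  by apply: stochastic_from_sub => L [].
have uni_coiso : unistochastic dot e `<=` coisometry_stochastic dot e.
  by apply: stochastic_from_sub => L [].
tfae.
- exact: am_sub.
- exact: invariant_under_sub.
- move=> inv; apply: (invariant_under_sub col_sub); apply: ortho_sub inv.
  by move=> P /ortho_dbl /dbl_row.
- exact: invariant_under_sub.
- move=> inv; apply: (invariant_under_sub (from_sub _)); exact: ortho_sub inv.
- move=> inv; apply: (invariant_under_sub (from_sub _)); apply: ortho_sub inv.
  by move=> P /ortho_uni /uni_iso.
- exact: invariant_under_sub.
- exact: invariant_under_sub.
- move=> inv; split; first exact: (orthostochastic_trace_class hdot he hI inv).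
  apply: (invariant_under_sub (@block_stochastic_substochastic _)); exact: ortho_sub inv.
- move=> [L1I inv]; split => //; apply: invariant_under_sub inv.
  by move=> P; exact: block_orthostochastic_block_stochastic.
- by move=> [L1I inv]; exact: (block_orthostochastic_am_closed hdot he hI L1I inv).
Qed.
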